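(* The VOA $U$ is rational, i.e. every admissible $U$-module is completely reducible.
   Context: Everything is over $\mathbb C$. $L(c,h)$ is the irreducible highest weight Virasoro module with central charge $c$ and highest weight $h$. $W(0)=L(\frac45,0)\oplus L(\frac45,3)$ and $N(0)=L(\frac67,0)\oplus L(\frac67,5)$ denote the (unique) simple VOA structures on these spaces; both are rational. $W(\frac23)^\pm$ are the two inequivalent irreducible $W(0)$-modules isomorphic to $L(\frac45,\frac23)$ over $L(\frac45,0)$, and $N(\frac43)^\pm$ are the two inequivalent irreducible $N(0)$-modules isomorphic to $L(\frac67,\frac43)$ over $L(\frac67,0)$. $U$ denotes the simple VOA, unique up to isomorphism, which is a $\mathbb Z_3$-graded extension $U=U^0\oplus U^1\oplus U^2$ of $U^0=W(0)\otimes N(0)$ (same vacuum and Virasoro vector, $Y(u,z)v\in U^{i+j}((z))$ for $u\in U^i,v\in U^j$) with $U^1=W(\frac23)^+\otimes N(\frac43)^+$ and $U^2=W(\frac23)^-\otimes N(\frac43)^-$. *)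

(* Defs.v *)
From HB Require Import structures.
From mathcomp Require Import all_boot all_order all_algebra.
From mathcomp Require Import complex.
From mathcomp Require Import all_classical reals.

Set Implicit Arguments.
Unset Strict Implicit.
Unset Printing Implicit Defensive.

Import Order.TTheory GRing.Theory Num.Theory.
Local Open Scope classical_set_scope.
Local Open Scope ring_scope.

(** * Subspaces, direct sums, operators on vector spaces of any dimension *)

Definition subspace (F : numFieldType) (M : lmodType F) (S : set M) : Prop :=
  S 0 /\ forall (a : F) (x y : M), S x -> S y -> S (a *: x + y).

Definition lin_span (F : numFieldType) (M : lmodType F) (A : set M) : set M :=
  [set x | exists2 s : seq (F * M),
     (forall p, p \in s -> A p.2) & x = \sum_(p <- s) p.1 *: p.2].

Definition finite_dim (F : numFieldType) (M : lmodType F) (S : set M) : Prop :=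
  exists s : seq M, S `<=` lin_span [set` s].

(* The space M is the internal direct sum of the subspaces S i. *)
Definition direct_sum (F : numFieldType) (M : lmodType F) (I : Type)
    (S : I -> set M) : Prop :=
  [/\ forall i, subspace (S i),
      lin_span (\bigcup_i S i) = setT &
      forall i, S i `&` lin_span (\bigcup_(j in [set j | j <> i]) S j) = [set 0]].

Definition invariant (F : numFieldType) (M : lmodType F) (J : Type)
    (op : J -> M -> M) (S : set M) : Prop :=
  subspace S /\ forall j x, S x -> S (op j x).

Definition irreducible (F : numFieldType) (M : lmodType F) (J : Type)
    (op : J -> M -> M) (S : set M) : Prop :=
  [/\ invariant op S, S <> [set 0] &
      forall T : set M, invariant op T -> T `<=` S -> T = [set 0] \/ T = S].

(** * Tensor products, by their universal property *)

Definition bilinear_map (F : numFieldType) (A B X : lmodType F)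
    (t : A -> B -> X) : Prop :=
  (forall b, linear (fun a => t a b)) /\ (forall a, linear (t a)).

Definition is_tensor (F : numFieldType) (A B T : lmodType F)
    (t : A -> B -> T) : Prop :=
  bilinear_map t /\
  forall (X : lmodType F) (f : A -> B -> X), bilinear_map f ->
    exists2 g : {linear T -> X}, (forall a b, g (t a b) = f a b) &
      forall g' : {linear T -> X}, (forall a b, g' (t a b) = f a b) -> g' =1 g.

(** * Virasoro modules *)

Definition virasoro_rel (F : numFieldType) (M : lmodType F) (c : F)
    (L : int -> M -> M) (S : set M) : Prop :=
  forall (m n : int) (x : M), S x ->
    L m (L n x) - L n (L m x) =
      (m - n)%:~R *: L (m + n) x
      + (if m + n == 0 then (m ^+ 3 - m)%:~R / 12%:R * c else 0) *: x.

(* The subspace S, with the operators L n, is a copy of L(c,h): an irreducible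
   Virasoro module of central charge c with a highest weight vector of weight h.
   Irreducibility makes that vector generate S. *)
Definition is_Lch (F : numFieldType) (M : lmodType F) (c h : F)
    (L : int -> M -> M) (S : set M) : Prop :=
  [/\ virasoro_rel c L S,
      irreducible L S &
      exists v : M, [/\ S v, v <> 0, L 0 v = h *: v &
                        forall n : int, 0 < n -> L n v = 0]].

(** * Vertex operator algebras

   A vertex operator Y(u,z) = \sum_n u_n z^(-n-1) is given by its modes:
   [Y u n v] is u_n v. *)

(* binomial coefficient with an integer upper argument *)
Definition binz (F : numFieldType) (m : int) (i : nat) : F :=
  (\prod_(j < i) (m - j%:Z)%:~R) / (i`!)%:R.

(* The coefficient of z0^(-l-1) z1^(-m-1) z2^(-n-1) in the Jacobi identity
     z0^-1 delta((z1-z2)/z0) Y(u,z1) Y(v,z2) w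
     - z0^-1 delta((z2-z1)/(-z0)) Y(v,z2) Y(u,z1) w
     = z2^-1 delta((z1-z0)/z2) Y(Y(u,z0)v,z2) w.
   By lower truncation both sums have finite support. *)
Definition jacobi (F : numFieldType) (V M : lmodType F)
    (Y : V -> int -> V -> V) (YM : V -> int -> M -> M) : Prop :=
  forall (u v : V) (w : M) (l m n : int),
    \sum_(i \in [set: nat])
       binz F m i *: YM (Y u (l + i%:Z) v) (m + n - i%:Z) w =
    \sum_(i \in [set: nat])
       ((-1) ^+ i * binz F l i) *:
         (YM u (m + l - i%:Z) (YM v (n + i%:Z) w)
          - ((-1) ^ l) *: YM v (n + l - i%:Z) (YM u (m + i%:Z) w)).

Definition vertex_operators (F : numFieldType) (V M : lmodType F)
    (YM : V -> int -> M -> M) : Prop :=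
  [/\ forall n w, linear (fun u => YM u n w),
      forall u n, linear (YM u n) &
      forall u w, exists N : int, forall n, N <= n -> YM u n w = 0].

Definition vacuum_axiom (F : numFieldType) (V M : lmodType F) (vac : V)
    (YM : V -> int -> M -> M) : Prop :=
  forall n w, YM vac n w = if n == -1 then w else 0.

Record voa (F : numFieldType) : Type := Voa {
  voa_sort :> lmodType F;
  Y : voa_sort -> int -> voa_sort -> voa_sort;
  vac : voa_sort;
  omega : voa_sort;
  cc : F;
  Y_operators : vertex_operators Y;
  Y_vacuum : vacuum_axiom vac Y;
  Y_creation : forall u, Y u (-1) vac = u /\
                 forall n : int, 0 <= n -> Y u n vac = 0;
  Y_jacobi : jacobi Y Y;
  Y_virasoro : virasoro_rel cc (fun n => Y omega (n + 1)) setT;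
  (* Y(L(-1)u, z) = d/dz Y(u, z) *)
  Y_derivative : forall u n v, Y (Y omega 0 u) n v = - n%:~R *: Y u (n - 1) v;
  (* grading by the eigenvalues of L(0), which is the mode omega_1 *)
  wt_direct_sum :
    direct_sum (fun k : int => [set v | Y omega 1 v = k%:~R *: v]);
  wt_finite_dim : forall k : int, finite_dim [set v | Y omega 1 v = k%:~R *: v];
  wt_bounded : exists N : int, forall (k : int) v, k < N ->
                 Y omega 1 v = k%:~R *: v -> v = 0
}.

Arguments Y {F} _ _ _ _.
Arguments vac {F} _.
Arguments omega {F} _.
Arguments cc {F} _.

Definition weight (F : numFieldType) (V : voa F) (k : int) : set V :=
  [set v | Y V (omega V) 1 v = k%:~R *: v].

Definition simple_voa (F : numFieldType) (V : voa F) : Prop :=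
  irreducible (fun p : V * int => Y V p.1 p.2) setT.

(** * Modules *)

Record weak_module (F : numFieldType) (V : voa F) : Type := WeakModule {
  module_sort :> lmodType F;
  YM : V -> int -> module_sort -> module_sort;
  YM_operators : vertex_operators YM;
  YM_vacuum : vacuum_axiom (vac V) YM;
  YM_jacobi : jacobi (Y V) YM
}.

Arguments YM {F V} _ _ _ _.

Definition irreducible_module (F : numFieldType) (V : voa F)
    (M : weak_module V) : Prop :=
  irreducible (fun p : V * int => YM M p.1 p.2) setT.

Definition module_iso (F : numFieldType) (V : voa F)
    (M M' : weak_module V) : Prop :=
  exists2 f : {linear M -> M'}, bijective f &
    forall u n x, f (YM M u n x) = YM M' u n (f x).

Definition int_graded (T : Type) (z : T) (G : nat -> set T) (k : int) : set T :=
  if k is Posz n then G n else [set z].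

(* An admissible module is an N-graded weak module, u_m raising degrees by
   wt u - m - 1; components of negative degree are zero. *)
Record admissible_module (F : numFieldType) (V : voa F) : Type := AdmissibleModule {
  adm_weak :> weak_module V;
  deg : nat -> set adm_weak;
  deg_direct_sum : direct_sum deg;
  deg_compat : forall (k : int) (u : V), weight k u ->
    forall (m : int) (n : nat) (x : adm_weak), deg n x ->
      int_graded 0 deg (n%:Z + k - m - 1) (YM adm_weak u m x)
}.

Arguments deg {F V} _ _.

(* Submodules of admissible modules are graded. *)
Definition adm_submodule (F : numFieldType) (V : voa F)
    (M : admissible_module V) (S : set M) : Prop :=
  invariant (fun p : V * int => YM M p.1 p.2) S /\
  S `<=` lin_span (\bigcup_n (S `&` deg M n)).

Definition adm_irreducible (F : numFieldType) (V : voa F)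
    (M : admissible_module V) (S : set M) : Prop :=
  [/\ adm_submodule S, S <> [set 0] &
      forall T : set M, adm_submodule T -> T `<=` S -> T = [set 0] \/ T = S].

Definition completely_reducible (F : numFieldType) (V : voa F)
    (M : admissible_module V) : Prop :=
  exists (I : Type) (S : I -> set M),
    (forall i, adm_irreducible (S i)) /\ direct_sum S.

Definition rational_voa (F : numFieldType) (V : voa F) : Prop :=
  forall M : admissible_module V, completely_reducible M.

(** * Tensor products of VOAs and of modules *)

(* Y(a (x) b, z) = Y(a, z) (x) Y(b, z); lower truncation makes the support
   of the sum finite. *)
Definition tensor_modes (F : numFieldType) (A B T P Q X : lmodType F)
    (t : A -> B -> T) (s : P -> Q -> X)
    (YP : A -> int -> P -> P) (YQ : B -> int -> Q -> Q)
    (YX : T -> int -> X -> X) : Prop :=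
  forall a b (n : int) p q,
    YX (t a b) n (s p q) =
    \sum_(i \in [set: int]) s (YP a i p) (YQ b (n - 1 - i) q).

Definition is_tensor_voa (F : numFieldType) (A B T : voa F)
    (t : A -> B -> T) : Prop :=
  [/\ is_tensor t,
      vac T = t (vac A) (vac B),
      omega T = t (omega A) (vac B) + t (vac A) (omega B),
      cc T = cc A + cc B &
      tensor_modes t t (Y A) (Y B) (Y T)].

Definition is_tensor_module (F : numFieldType) (A B T : voa F)
    (t : A -> B -> T) (P : weak_module A) (Q : weak_module B)
    (X : weak_module T) (s : P -> Q -> X) : Prop :=
  is_tensor s /\ tensor_modes t s (YM P) (YM Q) (YM X).

(** * The algebras W(0), N(0), their modules, and U *)

(* V is a simple VOA which is L(c,0) (+) L(c,h) as a module over the Virasoro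
   algebra spanned by its own L(n) = omega_(n+1). *)
Definition simple_voa_Lc0_Lch (F : numFieldType) (c h : F) (V : voa F) : Prop :=
  [/\ simple_voa V, cc V = c &
      exists A B : set V,
        [/\ is_Lch c 0 (fun n => Y V (omega V) (n + 1)) A,
            is_Lch c h (fun n => Y V (omega V) (n + 1)) B &
            direct_sum (fun b : bool => if b then A else B)]].

Definition is_W0 (F : numFieldType) (W : voa F) : Prop :=
  simple_voa_Lc0_Lch (4%:R / 5%:R) 3%:R W.

Definition is_N0 (F : numFieldType) (N : voa F) : Prop :=
  simple_voa_Lc0_Lch (6%:R / 7%:R) 5%:R N.

(* The vertex operator subalgebra L(c,0) is generated by the Virasoro vector,
   so a module over it is L(c,h) iff it is so as a Virasoro module. *)
Definition module_is_Lch (F : numFieldType) (V : voa F) (c h : F)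
    (M : weak_module V) : Prop :=
  is_Lch c h (fun n => YM M (omega V) (n + 1)) setT.

(* P and Q are inequivalent irreducible V-modules isomorphic to L(c,h) *)
Definition inequivalent_Lch_pair (F : numFieldType) (V : voa F) (c h : F)
    (P Q : weak_module V) : Prop :=
  [/\ irreducible_module P, irreducible_module Q,
      module_is_Lch c h P, module_is_Lch c h Q & ~ module_iso P Q].

Definition is_W23_pair (F : numFieldType) (W : voa F) (Wp Wm : weak_module W) :=
  inequivalent_Lch_pair (4%:R / 5%:R) (2%:R / 3%:R) Wp Wm.

Definition is_N43_pair (F : numFieldType) (N : voa F) (Np Nm : weak_module N) :=
  inequivalent_Lch_pair (6%:R / 7%:R) (4%:R / 3%:R) Np Nm.

(* f identifies the VOA T with the subalgebra G of U, with the same vacuum and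
   Virasoro vector. *)
Definition voa_iso_onto (F : numFieldType) (T U : voa F) (f : {linear T -> U})
    (G : set U) : Prop :=
  [/\ injective f, range f = G, f (vac T) = vac U, f (omega T) = omega U &
      forall x n y, f (Y T x n y) = Y U (f x) n (f y)].

(* f identifies the T-module X with the subspace G of U, T acting on G
   through f0 : T -> U. *)
Definition module_iso_onto (F : numFieldType) (T U : voa F) (f0 : {linear T -> U})
    (X : weak_module T) (f : {linear X -> U}) (G : set U) : Prop :=
  [/\ injective f, range f = G &
      forall u n x, f (YM X u n x) = Y U (f0 u) n (f x)].

(* U = U^0 (+) U^1 (+) U^2 is a simple Z_3-graded extension of the tensor
   product VOA U^0 = W (x) N, with U^1 = Wp (x) Np and U^2 = Wm (x) Nm as
   U^0-modules; the components U^i are [gr i]. *)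
Definition is_Z3_extension (F : numFieldType) (W N : voa F)
    (Wp Wm : weak_module W) (Np Nm : weak_module N) (U : voa F) : Prop :=
  simple_voa U /\
  exists gr : 'Z_3 -> set U,
    [/\ direct_sum gr,
        forall (i j : 'Z_3) u v n, gr i u -> gr j v -> gr (i + j) (Y U u n v) &
        exists (T : voa F) (t : W -> N -> T) (f0 : {linear T -> U}),
          [/\ is_tensor_voa t,
              voa_iso_onto f0 (gr 0),
              exists (X : weak_module T) (s : Wp -> Np -> X)
                     (f : {linear X -> U}),
                is_tensor_module t s /\ module_iso_onto f0 f (gr 1) &
              exists (X : weak_module T) (s : Wm -> Nm -> X)
                     (f : {linear X -> U}),
                is_tensor_module t s /\ module_iso_onto f0 f (gr 2%:R)]].

(* Main.v *)
Require Import Defs.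
From HB Require Import structures.
From mathcomp Require Import all_boot all_order all_algebra.
From mathcomp Require Import complex zify.
From mathcomp Require Import finmap all_classical reals.
From mathcomp Require lebesgue_measure.

(* Let M be an admissible U-module.  Restricted to W or to N it is a sum of
   graded irreducibles; on each of them L(0) minus the degree commutes with
   everything, hence is a scalar, so these are irreducible without the grading.
   Since W and N commute, Schur's lemma makes M semisimple over U^0 = W (x) N.
   Now let A be a graded U-submodule and rho a U^0-linear projection onto A.
   As U is simple, U^(-i) U^i contains the vacuum (unless U^1 = U^2 = 0), so
   rho has twists tau_i with v_n tau_i = rho v_n for v in U^i; their mean over
   Z_3 is a U-linear projection, and its part of degree 0 splits A off as a
   graded submodule. *)

Set Implicit Arguments.
Unset Strict Implicit.
Unset Printing Implicit Defensive.

Import Order.TTheory GRing.Theory Num.Theory.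
Local Open Scope classical_set_scope.
Local Open Scope ring_scope.

(** An admissible module may have infinite length and infinite-dimensional degree components.
    Irreducible subspaces therefore come from Zorn's lemma, and Schur's lemma cannot rest on an
    eigenvalue in finite dimension: it plays the countable dimension of an irreducible module, due
    to the finite-dimensional weight spaces of the VOA, against the uncountability of the complex
    field. Semisimplicity is handled for an arbitrary family of operators and in three forms: a sum
    of irreducibles passes from [W] and [N] to the pair, invariant complements give projections that
    can be averaged, and a direct sum is the goal. The grading has to be dropped for the tensor
    step, because a degree projection does not commute with the modes of the other factor. The final
    averaging is a Maschke argument, with the twists in the role of group conjugates. *)

Section Spans.
Variables (F : numFieldType) (M : lmodType F).
Implicit Types (S T A B : set M) (x y : M).

Lemma subspaceD S x y : subspace S -> S x -> S y -> S (x + y).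
Proof. by move=> [_ hS] Sx Sy; rewrite -(scale1r x); apply: hS. Qed.

Lemma subspaceZ S a x : subspace S -> S x -> S (a *: x).
Proof. by move=> [S0 hS] Sx; rewrite -(addr0 (_ *: _)); apply: hS. Qed.

Lemma subspaceN S x : subspace S -> S x -> S (- x).
Proof. by move=> hS Sx; rewrite -scaleN1r; apply: subspaceZ. Qed.

Lemma subspaceB S x y : subspace S -> S x -> S y -> S (x - y).
Proof. by move=> hS Sx Sy; apply: subspaceD => //; apply: subspaceN. Qed.

Lemma subspace_sum S (I : Type) (r : seq I) (P : pred I) (f : I -> M) :
  subspace S -> (forall i, P i -> S (f i)) -> S (\sum_(i <- r | P i) f i).
Proof.
by move=> hS Sf; apply: big_ind => //; [case: hS|move=> *; apply: subspaceD].
Qed.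

Lemma subspace_sum_seq S (I : eqType) (r : seq I) (f : I -> M) :
  subspace S -> (forall i, i \in r -> S (f i)) -> S (\sum_(i <- r) f i).
Proof. by move=> hS Sf; rewrite big_seq; apply: subspace_sum. Qed.

Lemma subspaceI S T : subspace S -> subspace T -> subspace (S `&` T).
Proof.
move=> [S0 hS] [T0 hT]; split=> // a x y [Sx Tx] [Sy Ty].
by split; [apply: hS|apply: hT].
Qed.

Lemma subspace_set0 : subspace [set (0 : M)].
Proof. by split=> // a x y -> ->; rewrite /= scaler0 addr0. Qed.

Lemma lin_span_subspace A : subspace (lin_span A).
Proof.
split; first by exists [::] => //; rewrite big_nil.
move=> a x y [s As ->] [t At ->].
exists ([seq (a * p.1, p.2) | p <- s] ++ t) => [p|].
  by rewrite mem_cat => /orP[/mapP[q qs ->]|]; [exact: (As q)|exact: At].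
rewrite big_cat big_map scaler_sumr; congr (_ + _).
by apply: eq_bigr => p _; rewrite scalerA.
Qed.

Lemma sub_lin_span A : A `<=` lin_span A.
Proof.
move=> x Ax; exists [:: (1, x)] => [p|]; last by rewrite big_seq1 scale1r.
by rewrite inE => /eqP ->.
Qed.

Lemma lin_span_min A S : subspace S -> A `<=` S -> lin_span A `<=` S.
Proof.
move=> hS AS x [s As ->]; apply: subspace_sum_seq => // p ps.
by apply: subspaceZ => //; apply/AS/As.
Qed.

Lemma lin_span_mono A B : A `<=` B -> lin_span A `<=` lin_span B.
Proof.
move=> AB; apply: lin_span_min; first exact: lin_span_subspace.
exact: subset_trans AB (@sub_lin_span B).
Qed.

Definition sumS S T : set M := [set x | exists s t, [/\ S s, T t & x = s + t]].

Lemma sumS_subspace S T : subspace S -> subspace T -> subspace (sumS S T).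
Proof.
move=> hS hT; split; first by exists 0, 0; rewrite addr0; split; case: hS; case: hT.
move=> a x y [s [t [Ss Tt ->]]] [s' [t' [Ss' Tt' ->]]].
exists (a *: s + s'), (a *: t + t'); split.
- by case: hS => _; apply.
- by case: hT => _; apply.
- by rewrite scalerDr addrACA.
Qed.

Lemma sumSl S T : subspace T -> S `<=` sumS S T.
Proof. by move=> [T0 _] x Sx; exists x, 0; rewrite addr0. Qed.

Lemma sumSr S T : subspace S -> T `<=` sumS S T.
Proof. by move=> [S0 _] x Tx; exists 0, x; rewrite add0r. Qed.

Lemma sumS_min S T A : subspace A -> S `<=` A -> T `<=` A -> sumS S T `<=` A.
Proof.
by move=> hA SA TA x [s [t [Ss Tt ->]]]; apply: subspaceD; [|apply: SA|apply: TA].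
Qed.

Lemma nonzero_subspace S : subspace S -> S <> [set 0] -> exists2 x, S x & x <> 0.
Proof.
move=> [S0 _] Sn0; apply: contrapT => h; apply: Sn0; apply/seteqP; split=> x /=.
  by move=> Sx; apply: contrapT => xn0; apply: h; exists x.
by move=> ->.
Qed.

Lemma sub_set0 S : subspace S -> S `<=` [set 0] -> S = [set 0].
Proof. by move=> [S0 _] h; apply/seteqP; split=> // x /= ->. Qed.

End Spans.

Section LinearFunctions.
Variables (F : numFieldType) (M M' : lmodType F).

Lemma linop0 (f : M -> M') : linear f -> f 0 = 0.
Proof. by move=> lf; have := lf (-1) 0 0; rewrite scaler0 addr0 scaleN1r addNr. Qed.

Lemma linopD (f : M -> M') : linear f -> forall x y, f (x + y) = f x + f y.
Proof. by move=> lf x y; rewrite -{1}(scale1r x) lf scale1r. Qed.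

Lemma linopZ (f : M -> M') : linear f -> forall a x, f (a *: x) = a *: f x.
Proof. by move=> lf a x; rewrite -{1}(addr0 (_ *: _)) lf linop0 // addr0. Qed.

Lemma linopB (f : M -> M') : linear f -> forall x y, f (x - y) = f x - f y.
Proof.
by move=> lf x y; rewrite linopD // -{1}(scaleN1r y) linopZ // scaleN1r.
Qed.

Lemma linop_sum (f : M -> M') : linear f ->
  forall (I : Type) (r : seq I) (P : pred I) (g : I -> M),
  f (\sum_(i <- r | P i) g i) = \sum_(i <- r | P i) f (g i).
Proof.
move=> lf I r P g; apply: (big_morph f); [exact: linopD|exact: linop0].
Qed.

End LinearFunctions.

(** * Semisimplicity for an arbitrary family of linear operators *)

Section Semisimple.
Variables (F : numFieldType) (M : lmodType F) (J : Type) (op : J -> M -> M).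
Hypothesis op_lin : forall j, linear (op j).
Implicit Types (S T A B P Q Z : set M) (x y : M).

Local Notation inv := (Defs.invariant op).
Local Notation irr := (Defs.irreducible op).

Lemma inv_set0 : inv [set 0].
Proof. by split=> [|j x /= ->]; [exact: subspace_set0|rewrite linop0]. Qed.

Lemma inv_setT : inv [set: M]. Proof. by []. Qed.

Lemma invI S T : inv S -> inv T -> inv (S `&` T).
Proof.
move=> [hS iS] [hT iT]; split; first exact: subspaceI.
by move=> j x [Sx Tx]; split; [apply: iS|apply: iT].
Qed.

Lemma inv_sumS S T : inv S -> inv T -> inv (sumS S T).
Proof.
move=> [hS iS] [hT iT]; split; first exact: sumS_subspace.
move=> j x [s [t [Ss Tt ->]]]; exists (op j s), (op j t).
by rewrite linopD //; split; [apply: iS|apply: iT|].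
Qed.

Lemma inv_span A : (forall j x, A x -> lin_span A (op j x)) -> inv (lin_span A).
Proof.
move=> hA; split; first exact: lin_span_subspace.
move=> j; apply: lin_span_min; last exact: hA.
have [l0 hl] := lin_span_subspace A; split; first by rewrite linop0.
by move=> a x y hx hy; rewrite op_lin; apply: hl.
Qed.

Lemma inv_span_bigcup (D : set (set M)) :
  (forall P, D P -> inv P) -> inv (lin_span (\bigcup_(P in D) P)).
Proof.
move=> hD; apply: inv_span => j x [P DP Px]; apply: sub_lin_span.
by exists P => //; apply: (hD P DP).2.
Qed.

Lemma irr_cap P Z : irr P -> inv Z -> ~ P `<=` Z -> P `&` Z = [set 0].
Proof.
move=> [iP _ mP] iZ nPZ; have [//|e] := mP _ (invI iP iZ) (@subIsetl _ _ _).
by exfalso; apply: nPZ; rewrite -e; apply: subIsetr.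
Qed.

Lemma irreducible_dichotomy P T : irr P -> inv T -> T `<=` P ->
  T = [set 0] \/ P `<=` T.
Proof. by move=> [_ _ h] iT TP; have [->|->] := h T iT TP; [left|right]. Qed.

(** An invariant [S] of this kind is its own socle. The notion is relative to [S] because it is
    later applied to the space of values at one vector of all homomorphisms out of an
    irreducible. *)
Definition spanned_by_irreducibles S :=
  S `<=` lin_span (\bigcup_(P in [set P | irr P /\ P `<=` S]) P).

Definition complemented :=
  forall S, inv S -> exists T, [/\ inv T, S `&` T = [set 0] & sumS S T = setT].

(** A family of irreducibles maximal among those whose sum [T] meets [S] in 0 works: an irreducible
    not inside [S + T] meets it in 0 and could be added to the family. *)
Lemma spanned_complemented : spanned_by_irreducibles setT -> complemented.
Proof.
move=> hM S iS.
pose good (G : set (set M)) :=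
  (forall P, G P -> irr P) /\ S `&` lin_span (\bigcup_(P in G) P) = [set 0].
have [C hC tC|G [[irrG SG] maxG]] := @Zorn_bigcup _ good.
  split=> [P [G CG GP]|]; first exact: (hC G CG).1 P GP.
  apply: sub_set0.
    by apply: subspaceI; [case: iS|apply: lin_span_subspace].
  move=> x [Sx [s hs ex]].
  (* The empty combination is split off because the chain may be empty. A nonempty one uses finitely
     many irreducibles, all of them in a single member of the chain. *)
  have [s0|sn0] := eqVneq s [::]; first by rewrite ex s0 big_nil.
  have [G CG hG] : exists2 G, C G &
      forall p, p \in s -> (\bigcup_(P in G) P) p.2.
    elim: s hs sn0 {ex} => // p s IH hs _.
    have [|P [G CG GP] Pp] := hs p; first by rewrite mem_head.
    have [s0|sn0] := eqVneq s [::].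
      by exists G => // q; rewrite s0 inE => /eqP ->; exists P.
    have [|G' CG' hG'] := IH _ sn0.
      by move=> q qs; apply: hs; rewrite inE qs orbT.
    have [GG'|G'G] := tC G G' CG CG'.
      exists G' => // q; rewrite inE => /orP[/eqP ->|]; last exact: hG'.
      by exists P => //; apply: GG'.
    exists G => // q; rewrite inE => /orP[/eqP ->|]; first by exists P.
    by move=> /hG' [Q GQ Qq]; exists Q => //; apply: G'G.
  by have <- := (hC G CG).2; split=> //; exists s.
set T := lin_span (\bigcup_(P in G) P) in SG.
have iT : inv T by apply: inv_span_bigcup => P /irrG [].
exists T; split=> //; apply/seteqP; split=> // x _.
have iST := inv_sumS iS iT.
apply: (lin_span_min iST.1 _ (hM x I)) => y [P [irrP _] Py].
apply: contrapT => nSTy.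
have nPST : ~ P `<=` sumS S T by move=> /(_ _ Py).
have PST := irr_cap irrP iST nPST.
pose G' := G `|` [set P].
have GG' : G `<=` G' by left.
have nG'G : ~ G' `<=` G.
  move=> h; apply: nPST; apply: subset_trans (sumSr iS.1).
  by move=> z Pz; apply: sub_lin_span; exists P => //; apply: h; right.
apply: (maxG G'); first by split.
split=> [Q [/irrG//|->//]|].
apply: sub_set0; first by apply: subspaceI; [case: iS|apply: lin_span_subspace].
move=> z [Sz zG'].
have [t [p [Tt Pp ez]]] : sumS T P z.
  apply: lin_span_min zG'; first by apply: sumS_subspace; [case: iT|case: irrP => -[]].
  move=> w [Q [GQ|->] Qw].
    apply: sumSl; first by case: irrP => -[].
    by apply: sub_lin_span; exists Q.
  by apply: sumSr => //; case: iT.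
have p0 : p = 0.
  suff: [set 0] p by [].
  rewrite -PST; split=> //; exists z, (- t); split=> //; last by rewrite ez addrC addKr.
  by apply: subspaceN => //; case: iT.
by rewrite -SG; split=> //; rewrite ez p0 addr0.
Qed.

(** Dedekind's modular law; it cuts a complement in the whole space down to one inside [E]. *)
Lemma modular S T E x : subspace E -> sumS S T = setT -> S `<=` E -> E x ->
  exists s t, [/\ S s, T t, E t & x = s + t].
Proof.
move=> hE ST SE Ex; have : sumS S T x by rewrite ST.
move=> [s [t [Ss Tt ex]]]; exists s, t; split=> //.
by rewrite -(addKr s t) -ex addrC; apply: subspaceB => //; apply: SE.
Qed.

Hypothesis compl : complemented.

Lemma exists_irreducible E : inv E -> E <> [set 0] ->
  exists2 P, irr P & P `<=` E.
Proof.
move=> iE En0; have [x Ex xn0] := nonzero_subspace iE.1 En0.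
(* A complement, inside E, of an invariant subspace of E maximal for not
   containing x is irreducible. *)
pose good A := A = set0 \/ [/\ inv A, A `<=` E & ~ A x].
have [C hC tC|A [gA maxA]] := @Zorn_bigcup _ good.
  (* The union of an empty chain is [set0], not a subspace, which is why [good] admits it. A maximal
     [A] is not empty, since [[set 0]] is larger and also qualifies. *)
  have [allC0|] := pselect (forall A, C A -> A = set0).
    by left; apply/seteqP; split=> // y [A /allC0 ->].
  move=> /existsNP[A0 /not_implyP[CA0 A0n0]]; right.
  have [//|[iA0 A0E nA0]] := hC _ CA0.
  split; last by move=> [A CA Ax]; have [e|[]//] := hC _ CA; rewrite e in Ax.
    split; last first.
      move=> j y [A CA Ay]; exists A => //.
      by have [e|[iA _ _]] := hC _ CA; [rewrite e in Ay|apply: iA.2].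
    split; first by exists A0 => //; case: iA0 => -[].
    move=> a y z [A CA Ay] [B CB Bz].
    have [e|[iA _ _]] := hC _ CA; first by rewrite e in Ay.
    have [e|[iB _ _]] := hC _ CB; first by rewrite e in Bz.
    have [AB|BA] := tC _ _ CA CB.
      by exists B => //; apply: iB.1.2 => //; apply: AB.
    by exists A => //; apply: iA.1.2 => //; apply: BA.
  by move=> y [A CA Ay]; have [e|[_ AE _]] := hC _ CA; [rewrite e in Ay|apply: AE].
have {gA} [iA AE nAx] : [/\ inv A, A `<=` E & ~ A x].
  case: gA => // A0; exfalso; apply: (maxA [set 0]).
    by rewrite A0; split=> // /(_ 0); apply.
  right; split; first exact: inv_set0.
    by move=> y /= ->; case: iE => -[].
  exact: xn0.
have [T [iT AT ATT]] := compl iA.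
exists (T `&` E); last exact: subIsetr.
have iTE := invI iT iE.
split=> //.
  move=> TE0; apply: nAx.
  have [s [t [As Tt Et ->]]] := modular iE.1 ATT AE Ex.
  suff -> : t = 0 by rewrite addr0.
  by have : (T `&` E) t by []; rewrite TE0.
move=> D iD DTE; have [D0|Dn0] := pselect (D = [set 0]); [by left|right].
apply/seteqP; split=> // y [Ty Ey].
(* By maximality of [A], adding a nonzero invariant [B] inside [T] forces [x] into [A + B]. If [D]
   and its complement in [T & E] were both nonzero, [x] would lie in both sums; comparing the two,
   [A & T = 0] and [D & D' = 0] put [x] in [A]. *)
have big B : inv B -> B `<=` T `&` E -> B <> [set 0] -> sumS A B x.
  move=> iB BTE Bn0; apply: contrapT => nAB; apply: (maxA (sumS A B)).
    split=> [|h]; first exact: sumSl iB.1.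
    apply: Bn0; apply: sub_set0; first by case: iB.
    move=> b Bb; rewrite -AT; split; last by have [] := BTE _ Bb.
    by apply/h/sumSr => //; case: iA.
  right; split=> //; first exact: inv_sumS.
  by apply: sumS_min => //; [case: iE|move=> b /BTE []].
have [D' [iD' DD' DDT]] := compl iD.
have [d [d' [Dd D'd' TEd' ->]]] := modular iTE.1 DDT DTE (conj Ty Ey).
suff -> : d' = 0 by rewrite addr0.
apply: contrapT => d'n0.
have [a [b [Aa Db ex]]] := big _ iD DTE Dn0.
have [|a' [b' [Aa' [D'b' TEb'] ex']]] :=
  big (D' `&` (T `&` E)) (invI iD' iTE) (@subIsetr _ _ _).
  by move=> e; apply: d'n0; have : (D' `&` (T `&` E)) d' by []; rewrite e.
have ebb : b - b' = a' - a.
  by apply/eqP; rewrite subr_eq addrAC eq_sym subr_eq -ex' ex addrC.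
have bb0 : b - b' = 0.
  suff: [set 0] (b - b') by [].
  rewrite -AT; split; first by rewrite ebb; apply: subspaceB => //; case: iA.
  by apply: subspaceB; [case: iT|case: (DTE _ Db)|case: TEb'].
have b0 : b = 0.
  suff: [set 0] b by [].
  by rewrite -DD'; split=> //; rewrite (subr0_eq bb0).
by apply: nAx; rewrite ex b0 addr0.
Qed.

(** A complement of the socle of [E], cut down to [E], would contain an irreducible if it were
    nonzero, and that irreducible would lie in the socle. *)
Lemma complemented_spanned E : inv E -> spanned_by_irreducibles E.
Proof.
move=> iE x Ex.
set D := [set P | irr P /\ P `<=` E].
have iS : inv (lin_span (\bigcup_(P in D) P)).
  by apply: inv_span_bigcup => P [[]].
have SE : lin_span (\bigcup_(P in D) P) `<=` E.
  by apply: lin_span_min; [case: iE|move=> y [P [_ PE]] /PE].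
have [T [iT ST STT]] := compl iS.
have [s [t [Ss Tt Et ->]]] := modular iE.1 STT SE Ex.
suff -> : t = 0 by rewrite addr0.
apply: contrapT => tn0.
have [|P irrP PTE] := exists_irreducible (invI iT iE).
  by move=> e; apply: tn0; have : (T `&` E) t by []; rewrite e.
have [iP Pn0 _] := irrP; apply: Pn0; apply: sub_set0; first by case: iP.
move=> y Py; rewrite -ST; split; last by case: (PTE _ Py).
by apply: sub_lin_span; exists P => //; split=> // z /PTE [].
Qed.

(** Zorn's lemma on independent families of irreducibles: an irreducible outside the sum of a
    maximal family could be adjoined. The summands are indexed by the members of the family, so none
    is repeated. *)
Lemma complemented_direct_sum :
  exists (I : Type) (S : I -> set M), (forall i, irr (S i)) /\ direct_sum S.
Proof.
pose indep (G : set (set M)) := forall P, G P ->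
  irr P /\ P `&` lin_span (\bigcup_(Q in G `&` [set Q | Q <> P]) Q) = [set 0].
have [C hC tC|G [iG maxG]] := @Zorn_bigcup _ indep.
  move=> P [G CG GP]; have [irrP _] := hC _ CG _ GP; split=> //.
  apply: sub_set0.
    by apply: subspaceI; [case: irrP => -[]|apply: lin_span_subspace].
  move=> x [Px [s hs ex]].
  have [G' [CG' G'P hG']] : exists G', [/\ C G', G' P &
      forall p, p \in s -> (\bigcup_(Q in G' `&` [set Q | Q <> P]) Q) p.2].
    elim: s hs {ex} => [|p s IH] hs; first by exists G.
    have [|Q [[G1 CG1 G1Q] QP] Qp] := hs p; first by rewrite mem_head.
    have [|G2 [CG2 G2P hG2]] := IH.
      by move=> q qs; apply: hs; rewrite inE qs orbT.
    have [G12|G21] := tC _ _ CG1 CG2.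
      exists G2; split=> // q; rewrite inE => /orP[/eqP ->|]; last exact: hG2.
      by exists Q => //; split=> //; apply: G12.
    exists G1; split=> //; first exact: G21.
    move=> q; rewrite inE => /orP[/eqP ->|]; first by exists Q.
    by move=> /hG2 [Q' [G2Q' Q'P] Q'q]; exists Q' => //; split=> //; apply: G21.
  by have [_ <-] := hC _ CG' _ G'P; split=> //; exists s.
exists {P | G P}, (fun i => sval i); split=> [[P GP]|]; first exact: (iG _ GP).1.
have GT : lin_span (\bigcup_(P in G) P) = setT.
  apply/seteqP; split=> // x _.
  have iS : inv (lin_span (\bigcup_(P in G) P)).
    by apply: inv_span_bigcup => P GP; case: (iG _ GP) => -[].
  apply: (lin_span_min iS.1 _ (@complemented_spanned setT inv_setT x I)).
  move=> y [P [irrP _] Py]; apply: contrapT => nPy.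
  have nP : ~ P `<=` lin_span (\bigcup_(P in G) P) by move=> h; apply: nPy; apply: h.
  have PS := irr_cap irrP iS nP.
  have hP : subspace P by case: irrP => -[].
  have nGP : ~ G P.
    by move=> GP; apply: nP => z Pz; apply: sub_lin_span; exists P.
  apply: (maxG (G `|` [set P])).
    by split=> [Q GQ|h]; [left|apply: nGP; apply: h; right].
  move=> Q [GQ|eQ].
    have [irrQ QG] := iG _ GQ; split=> //.
    apply: sub_set0.
      by apply: subspaceI; [case: irrQ => -[]|apply: lin_span_subspace].
    move=> z [Qz zG].
    have hspan := lin_span_subspace (\bigcup_(Q' in G `&` [set Q' | Q' <> Q]) Q').
    have [t [p [Tt Pp ez]]] :
        sumS (lin_span (\bigcup_(Q' in G `&` [set Q' | Q' <> Q]) Q')) P z.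
      apply: lin_span_min zG; first exact: sumS_subspace.
      move=> w [Q' [[GQ'|->] Q'Q] Q'w]; last exact: sumSr.
      by apply: sumSl => //; apply: sub_lin_span; exists Q'.
    have p0 : p = 0.
      suff: [set 0] p by [].
      rewrite -PS; split=> //.
      have -> : p = z - t by rewrite ez addrC addKr.
      apply: subspaceB; first by case: iS.
        by apply: sub_lin_span; exists Q.
      by apply: lin_span_mono Tt => w [Q' [GQ' _] Q'w]; exists Q'.
    by rewrite -QG; split=> //; rewrite ez p0 addr0.
  rewrite eQ; split=> //; apply: sub_set0.
    by apply: subspaceI => //; apply: lin_span_subspace.
  move=> z [Pz zG]; rewrite -PS; split=> //.
  by apply: lin_span_mono zG => w [Q' [[GQ'|->//] _] Q'w]; exists Q'.
split.
- by move=> [P GP]; case: (iG _ GP) => -[[]].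
- rewrite -GT; congr lin_span; apply/seteqP; split=> x.
    by move=> [[P GP] _ Px]; exists P.
  by move=> [P GP Px]; exists (exist _ P GP).
- move=> [P GP] /=; have [irrP <-] := iG _ GP; congr (_ `&` lin_span _).
  apply/seteqP; split=> x.
    move=> [[Q GQ] /= nQP Qx]; exists Q => //; split=> // eQP; apply: nQP.
    by move: GQ Qx; rewrite eQP => GQ Qx; congr exist; apply: Prop_irrelevance.
  move=> [Q [GQ QP] Qx]; exists (exist _ Q GQ) => //= e.
  by apply: QP; have := congr1 sval e.
Qed.

End Semisimple.

(** * Projections onto the summands of a direct sum, and gradings by natural numbers *)

Section Components.
Variables (F : numFieldType) (M : lmodType F) (I : eqType) (S : I -> set M).
Hypothesis dS : direct_sum S.
Implicit Types (x y : M) (i j : I).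

Lemma ds_subspace i : subspace (S i). Proof. by case: dS. Qed.

Lemma ds_ind (P : set M) : subspace P -> (forall i x, S i x -> P x) -> forall x, P x.
Proof.
move=> hP SP x; have [_ h _] := dS.
have : [set: M] x by [].
by rewrite -h; apply: lin_span_min => // y [i _]; apply: SP.
Qed.

Lemma ds_ext (M' : lmodType F) (f g : M -> M') : linear f -> linear g ->
  (forall i x, S i x -> f x = g x) -> f =1 g.
Proof.
move=> lf lg fg; apply: (@ds_ind [set x | f x = g x]) => //.
split=> [|a x y] /=; first by rewrite !linop0.
by rewrite lf lg => -> ->.
Qed.

Definition others i : set M := lin_span (\bigcup_(j in [set j | j <> i]) S j).

Definition component i x : M := xget 0 [set y | S i y /\ others i (x - y)].

Lemma others_subspace i : subspace (others i).
Proof. exact: lin_span_subspace. Qed.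

Lemma component_uniq i x y z : S i y -> others i (x - y) ->
  S i z -> others i (x - z) -> y = z.
Proof.
move=> Sy oy Sz oz; apply/eqP; rewrite -subr_eq0; apply/eqP.
suff: [set 0] (y - z) by [].
have [_ _ h] := dS; rewrite -(h i); split; first exact: (subspaceB (ds_subspace i)).
have -> : y - z = (x - z) - (x - y) by rewrite opprB [RHS]addrC addrA addrNK.
exact: (subspaceB (others_subspace i)).
Qed.

Lemma componentP i x : S i (component i x) /\ others i (x - component i x).
Proof.
suff: exists y, S i y /\ others i (x - y).
  exact: (xgetPex 0).
move: x; apply: ds_ind => /= [|j x Sx].
  split=> [|a x y [x' [Sx ox]] [y' [Sy oy]]].
    by exists 0; rewrite subr0; split; [case: (ds_subspace i)|case: (others_subspace i)].
  exists (a *: x' + y'); split; first by apply: (ds_subspace i).2.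
  rewrite opprD addrACA -scalerBr; exact: (others_subspace i).2.
have [ij|ij] := eqVneq j i.
  by exists x; rewrite subrr -ij; split=> //; case: (others_subspace j).
exists 0; rewrite subr0; split; first by case: (ds_subspace i).
by apply: sub_lin_span; exists j => //; apply/eqP.
Qed.

Lemma componentE i x y : S i y -> others i (x - y) -> component i x = y.
Proof. by move=> Sy oy; have [h1 h2] := componentP i x; apply: component_uniq h1 h2 Sy oy. Qed.

Lemma component_in i x : S i (component i x).
Proof. by case: (componentP i x). Qed.

Lemma component_lin i : linear (component i).
Proof.
move=> a x y; have [Sx ox] := componentP i x; have [Sy oy] := componentP i y.
apply: componentE; first by apply: (ds_subspace i).2.
rewrite opprD addrACA -scalerBr; exact: (others_subspace i).2.
Qed.

Lemma component_id i x : S i x -> component i x = x.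
Proof.
by move=> Sx; apply: componentE; rewrite // subrr; case: (others_subspace i).
Qed.

Lemma component_other i j x : S j x -> j <> i -> component i x = 0.
Proof.
move=> Sx ij; apply: componentE; first by case: (ds_subspace i).
by rewrite subr0; apply: sub_lin_span; exists j.
Qed.

Lemma component_decomp x : exists r : seq I,
  [/\ uniq r, forall i, i \notin r -> component i x = 0 &
      x = \sum_(i <- r) component i x].
Proof.
(* Allowing every duplicate-free list that contains [r] makes the claim stable under linear
   combinations: the two lists are simply concatenated. *)
suff [r hr] : exists r : seq I, forall r', uniq r' -> {subset r <= r'} ->
    x = \sum_(i <- r') component i x.
  have ex : x = \sum_(i <- undup r) component i x.
    by apply: hr => [|i]; rewrite ?undup_uniq ?mem_undup.
  exists (undup r); split; rewrite ?undup_uniq // => i ir.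
  rewrite ex (linop_sum (component_lin i)) big_seq big1 // => j jr.
  apply: (@component_other _ j); first exact: component_in.
  by move=> ji; rewrite -ji jr in ir.
move: x; apply: ds_ind => /= [|i x Sx].
  split=> [|a x y [r hr] [s hs]].
    by exists [::] => r' _ _; rewrite big1 // => i _; rewrite linop0 //; apply: component_lin.
  exists (r ++ s) => r' ur' sr'; rewrite {1}(hr r') //; last first.
    by move=> i ir; apply: sr'; rewrite mem_cat ir.
  rewrite {1}(hs r') //; last by move=> i ir; apply: sr'; rewrite mem_cat ir orbT.
  rewrite scaler_sumr -big_split; apply: eq_bigr => i _.
  by rewrite component_lin.
exists [:: i] => r' ur' /(_ i); rewrite mem_head => /(_ isT) ir'.
rewrite (bigD1_seq i) //= component_id // big1 ?addr0 // => j ji.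
by apply: component_other Sx _; apply/eqP; rewrite eq_sym.
Qed.

Lemma component_ext x y : (forall i, component i x = component i y) -> x = y.
Proof.
move=> xy; apply/eqP; rewrite -subr_eq0; apply/eqP.
have [r [_ _ ->]] := component_decomp (x - y).
by rewrite big1 // => i _; rewrite (linopB (component_lin i)) xy subrr.
Qed.

End Components.

Section NatGraded.
Variables (F : numFieldType) (M : lmodType F) (S : nat -> set M).
Hypothesis dS : direct_sum S.
Local Notation pi := (component S).

Lemma component_bound x : exists B, forall n, (B <= n)%N -> pi n x = 0.
Proof.
have [r [_ hr _]] := component_decomp dS x.
exists (\max_(i <- r) i).+1 => n hn; apply: hr; apply/negP => nr.
by move: hn; rewrite ltnNge (leq_bigmax_seq n (F := id) (P := xpredT) nr isT).
Qed.

(** Serves to define operators degree by degree, such as multiplication by the degree; the bound [B]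
    keeps the sum of the pieces finite. *)
Lemma glue (f : nat -> M) B : (forall n, S n (f n)) ->
  (forall n, (B <= n)%N -> f n = 0) -> exists y, forall n, pi n y = f n.
Proof.
move=> Sf f0; exists (\sum_(i < B) f i) => n.
rewrite (linop_sum (component_lin dS n)).
have [nB|Bn] := ltnP n B.
  rewrite (bigD1 (Ordinal nB)) //= component_id // big1 ?addr0 // => i.
  move=> /eqP ni; apply: (component_other dS (Sf i)) => e.
  by apply: ni; apply: val_inj.
rewrite f0 // big1 // => i _; apply: (component_other dS (Sf i)) => e.
by have := ltn_ord i; rewrite e ltnNge Bn.
Qed.

(** A map homogeneous of degree [s] reaches degree [N] only from degree [N - s]; the second
    alternative is the case [N - s < 0]. *)
Lemma component_shift (f : M -> M) (s : int) : linear f ->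
    (forall n x, S n x -> int_graded 0 S (n%:Z + s) (f x)) ->
  forall N : nat, (exists n : nat, forall x, pi N (f x) = f (pi n x)) \/
                  (forall x, pi N (f x) = 0).
Proof.
move=> lf hf N.
have lN : linear (fun x => pi N (f x)).
  by move=> a x y; rewrite lf component_lin.
have other n x : S n x -> n%:Z + s <> N -> pi N (f x) = 0.
  move=> /hf; case: (n%:Z + s) => [m|m] /= h nm; last first.
    by rewrite h linop0 //; apply: component_lin.
  by apply: component_other h _ => // e; apply: nm; rewrite e.
case e: (N%:Z - s) => [n|n]; [left; exists n|right].
  apply: (ds_ext dS) => //.
    by move=> a x y; rewrite component_lin // lf.
  move=> m x Sx; have [mn|mn] := eqVneq m n.
    have h : n%:Z + s = N by rewrite -[n%:Z]e addrNK.
    subst m; have := hf _ _ Sx; rewrite h /= => Sfx.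
    by rewrite !component_id.
  rewrite (component_other dS Sx); last by apply/eqP.
  rewrite linop0 // (other m) // => h; move: mn => /eqP; apply.
  by have [] : m%:Z = n by rewrite -[n%:Z]e -h addrK.
apply: (ds_ext dS) => //; first by move=> a x y; rewrite scaler0 addr0.
move=> m x Sx; apply: other Sx _ => h.
by move: e; rewrite -h addrK.
Qed.

End NatGraded.

(** * Graded submodules as invariant subspaces *)

Section GradedOperators.
Variables (F : numFieldType) (V : voa F) (M : admissible_module V).

Lemma YM_lin (W : weak_module V) u n : linear (YM W u n).
Proof. by case: (YM_operators W). Qed.

(** Adding the degree projections to the modes turns graded submodules into plain invariant
    subspaces, so that the general semisimplicity results apply to them. *)
Definition modes_and_degrees (j : V * int + nat) : M -> M :=
  match j with inl p => YM M p.1 p.2 | inr n => component (deg M) n end.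

Lemma modes_and_degrees_lin j : linear (modes_and_degrees j).
Proof.
by case: j => [p|n] /=; [exact: YM_lin|exact: component_lin (deg_direct_sum M) n].
Qed.

Lemma adm_submoduleP (S : set M) :
  adm_submodule S <-> Defs.invariant modes_and_degrees S.
Proof.
have dM := deg_direct_sum M.
split=> [[[hS iS] gS]|[hS iS]].
  split=> // -[p|n] x Sx /=; first exact: (iS p).
  move: (gS _ Sx); apply: (@lin_span_min _ _ _ [set x | S (component (deg M) n x)]).
    case: (hS) => S0 hS'; split=> [|a y z] /=.
      by rewrite linop0 //; apply: component_lin.
    by rewrite component_lin //; apply: hS'.
  move=> y [m _ [Sy my]] /=; have [mn|mn] := eqVneq m n.
    by rewrite component_id -?mn.
  by rewrite (component_other dM my); [case: hS|apply/eqP].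
split; first by split=> // p x Sx; apply: (iS (inl p)).
move=> x Sx; have [r [_ _ ->]] := component_decomp dM x.
apply: subspace_sum; first exact: lin_span_subspace.
move=> n _; apply: sub_lin_span; exists n => //; split; first exact: (iS (inr n)).
exact: component_in.
Qed.

Lemma adm_irreducibleP (S : set M) :
  adm_irreducible S <-> Defs.irreducible modes_and_degrees S.
Proof.
split=> -[h1 h2 h3]; split=> //; try exact/adm_submoduleP.
  by move=> T /adm_submoduleP; apply: h3.
by move=> T /adm_submoduleP; apply: h3.
Qed.

End GradedOperators.

(** * Schur's lemma in countable dimension over an uncountable algebraically closed field *)

Section Schur.
Variable F : numClosedFieldType.
Hypothesis F_uncountable : ~ countable [set: F].
Variables (M : lmodType F) (J : Type) (op : J -> M -> M).
Hypothesis op_lin : forall j, linear (op j).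
Variables (P : set M) (e : nat -> M) (theta : M -> M).
Hypothesis irrP : Defs.irreducible op P.
Hypothesis spanP : P `<=` lin_span (range e).
Hypothesis theta_in : forall x, P x -> P (theta x).
Hypothesis theta_lin :
  forall a x y, P x -> P y -> theta (a *: x + y) = a *: theta x + theta y.
Hypothesis theta_comm : forall j x, P x -> theta (op j x) = op j (theta x).

Implicit Types (p q : {poly F}) (x y : M) (c : F).

Let invP : Defs.invariant op P. Proof. by case: irrP. Qed.
Let subP : subspace P. Proof. by case: invP. Qed.
Let P0 : P 0. Proof. by case: subP. Qed.

Let theta0 : theta 0 = 0.
Proof.
by have := theta_lin (-1) P0 P0; rewrite scaler0 addr0 scaleN1r addNr.
Qed.

Let theta_sum (I : Type) (r : seq I) (a : I -> F) (f : I -> M) :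
  (forall i, P (f i)) ->
  theta (\sum_(i <- r) a i *: f i) = \sum_(i <- r) a i *: theta (f i).
Proof.
move=> Pf; elim: r => [|i r IH]; first by rewrite !big_nil theta0.
rewrite !big_cons theta_lin ?IH //; apply: subspace_sum => // k _.
exact: subspaceZ.
Qed.

Let iter_in n x : P x -> P (iter n theta x).
Proof. by move=> Px; elim: n => //= n IH; apply: theta_in. Qed.

(** The value of [q(theta)] at [x], which makes [P] a module over the polynomial ring. *)
Let act (q : {poly F}) x : M := \sum_(i < size q) q`_i *: iter i theta x.

Let act_widen N q x : (size q <= N)%N -> act q x = \sum_(i < N) q`_i *: iter i theta x.
Proof.
move=> qN; rewrite /act (big_ord_widen N (fun i => q`_i *: iter i theta x)) //.
rewrite big_mkcond /=; apply: eq_bigr => i _.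
by case: ltnP => // h; rewrite nth_default ?scale0r.
Qed.

Let act_in q x : P x -> P (act q x).
Proof.
move=> Px; apply: subspace_sum => // i _.
by apply: subspaceZ => //; apply: iter_in.
Qed.

Let act1 x : act 1 x = x.
Proof. by rewrite /act size_poly1 big_ord1 coef1 scale1r. Qed.

Let act_scale a q x : act (a *: q) x = a *: act q x.
Proof.
rewrite (@act_widen (size q)) ?size_scale_leq // /act scaler_sumr.
by apply: eq_bigr => i _; rewrite coefZ scalerA.
Qed.

Let act_sum (I : Type) (r : seq I) (f : I -> {poly F}) x :
  act (\sum_(i <- r) f i) x = \sum_(i <- r) act (f i) x.
Proof.
apply: (big_morph (fun q => act q x)) => [p q|]; last first.
  by rewrite /act size_poly0 big_ord0.
pose N := maxn (size p) (size q).
rewrite !(@act_widen N) ?leq_maxl ?leq_maxr // ?size_polyD //.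
by rewrite -big_split; apply: eq_bigr => i _; rewrite coefD scalerDl.
Qed.

Let act_XsubC c q x : P x ->
  act (('X - c%:P) * q) x = theta (act q x) - c *: act q x.
Proof.
move=> Px; rewrite [in LHS](@act_widen (size q).+1); last first.
  by rewrite (leq_trans (size_polyMleq _ _)) // size_XsubC.
rewrite [in c *: _](@act_widen (size q).+1) // /act theta_sum; last first.
  by move=> i; apply: iter_in.
rewrite scaler_sumr [in RHS]big_ord_recl [in LHS]big_ord_recl opprD.
rewrite mulrBl coefB coefXM coefCM /= sub0r scaleNr scalerA addrCA; congr (_ + _).
rewrite -sumrB; apply: eq_bigr => i _.
by rewrite coefB coefXM coefCM /= scalerBl scalerA.
Qed.

Hypothesis not_scalar : forall c, exists2 x, P x & theta x <> c *: x.

(** The eigenspace of [theta] for [c] is invariant, and it is not all of [P] since [theta] is not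
    scalar; irreducibility leaves 0. The image of [theta - c] is treated in the same way next. *)
Let resolvent_inj c x : P x -> theta x - c *: x = 0 -> x = 0.
Proof.
move=> Px xc.
have [||h|h] := irreducible_dichotomy irrP (T := [set x | P x /\ theta x = c *: x]).
- split; last first.
    by move=> j y [Py yc]; split; [apply: invP.2|rewrite theta_comm // yc (linopZ (op_lin j))].
  split; first by split=> //; rewrite theta0 scaler0.
  move=> a y z [Py yc] [Pz zc]; split; first exact: subP.2.
  by rewrite theta_lin // yc zc scalerDr !scalerA mulrC.
- by move=> y [].
- have : [set 0] x by rewrite -h; split=> //; apply/subr0_eq.
  by [].
- by have [y Py] := not_scalar c; have [_] := h _ Py.
Qed.

Let resolvent_surj c y : P y -> exists2 x, P x & theta x - c *: x = y.
Proof.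
move=> Py.
have [||h|h] := irreducible_dichotomy irrP (T := [set y | exists2 x, P x & theta x - c *: x = y]).
- split; last first.
    move=> j z [x Px <-]; exists (op j x); first exact: invP.2.
    by rewrite theta_comm // (linopB (op_lin j)) (linopZ (op_lin j)).
  split; first by exists 0 => //; rewrite theta0 scaler0 subr0.
  move=> a z z' [x Px <-] [x' Px' <-]; exists (a *: x + x'); first exact: subP.2.
  by rewrite theta_lin // scalerBr scalerDr !scalerA mulrC opprD addrACA.
- by move=> z [x Px <-]; apply: subspaceB => //; [apply: theta_in|apply: subspaceZ].
- have [x Px xc] := not_scalar c; exfalso; apply: xc; apply/subr0_eq.
  have : [set 0] (theta x - c *: x) by rewrite -h; exists x.
  by [].
- exact: h.
Qed.

Let act_prod_surj (s : seq F) y : P y ->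
  exists2 x, P x & act (\prod_(c <- s) ('X - c%:P)) x = y.
Proof.
move: y; elim: s => [|c s IH] y Py; first by exists y; rewrite // big_nil act1.
have [z Pz <-] := resolvent_surj c Py; have [x Px <-] := IH _ Pz.
by exists x => //; rewrite big_cons act_XsubC.
Qed.

(** Algebraic closedness enters here: [q] splits into linear factors, each of which acts injectively
    on [P]. *)
Let act_neq0 q x : P x -> x <> 0 -> q != 0 -> act q x <> 0.
Proof.
move=> Px xn0 qn0; have [r ->] := closed_field_poly_normal q.
rewrite act_scale => /eqP; rewrite scaler_eq0 lead_coef_eq0 (negPf qn0) /=.
elim: r => [|c r IH]; first by rewrite big_nil act1 => /eqP.
rewrite big_cons act_XsubC // => /eqP /resolvent_inj h; apply: IH; apply/eqP/h.
exact: act_in.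
Qed.

Let finite_span x : P x -> exists n (b : nat -> F), x = \sum_(j < n) b j *: e j.
Proof.
move=> /spanP; suff h : lin_span (range e) `<=` [set x | exists n (b : nat -> F),
    (forall j, (n <= j)%N -> b j = 0) /\ x = \sum_(j < n) b j *: e j].
  by move=> /h [n [b [_ ->]]]; exists n, b.
have widen n m (b : nat -> F) : (n <= m)%N -> (forall j, (n <= j)%N -> b j = 0) ->
    \sum_(j < n) b j *: e j = \sum_(j < m) b j *: e j.
  move=> nm b0; rewrite (big_ord_widen m (fun j => b j *: e j)) //.
  rewrite big_mkcond; apply: eq_bigr => i _.
  by case: ltnP => // h; rewrite b0 ?scale0r.
apply: lin_span_min => [|x' [k _ <-]].
  split=> [|a x' y [n [b [b0 ->]]] [m [d [d0 ->]]]].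
    by exists 0%N, (fun=> 0); rewrite big_ord0.
  exists (maxn n m), (fun j => a * b j + d j); split.
    by move=> j; rewrite geq_max => /andP[nj mj]; rewrite b0 // d0 // mulr0 addr0.
  rewrite (widen n (maxn n m)) ?leq_maxl // (widen m (maxn n m)) ?leq_maxr //.
  rewrite scaler_sumr -big_split; apply: eq_bigr => j _.
  by rewrite scalerDl scalerA.
exists k.+1, (fun j => (j == k)%:R); split.
  by move=> j kj; rewrite gtn_eqF.
rewrite big_ord_recr /= eqxx scale1r big1 ?add0r // => i _.
by rewrite ltn_eqF ?scale0r.
Qed.

Lemma nonscalar_commutant_False : False.
Proof.
have [p Pp pn0] : exists2 p, P p & p <> 0.
  by apply: nonzero_subspace => //; case: irrP.
have /choice[r hr] : forall c, exists x, P x /\ theta x - c *: x = p.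
  by move=> c; have [x Px xc] := resolvent_surj c Pp; exists x.
(* Each [r c], the resolvent at [c] applied to [p], lies in the span of finitely many [e j].
   Countably many finite sets cannot cover the field, so for some [n] infinitely many [r c] lie in
   the span of the first [n] vectors, and any [n + 1] of these are dependent. *)
pose A n := [set c | exists b : nat -> F, r c = \sum_(j < n) b j *: e j].
have [n infA] : exists n, infinite_set (A n).
  apply: contrapT => /forallNP finA; apply: F_uncountable.
  have -> : [set: F] = \bigcup_n A n.
    apply/seteqP; split=> // c _.
    by have [n [b h]] := finite_span (hr c).1; exists n => //; exists b.
  apply: bigcup_countable => // n _; apply: finite_set_countable.
  exact: contrapT (finA n).
have [B BA sB] := infinite_set_fset n.+1 infA.
pose s := take n.+1 (enum_fset B).
have ss : size s = n.+1 by rewrite size_takel.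
have us : uniq s by rewrite take_uniq ?fset_uniq.
have sA c : c \in s -> A n c by move=> /mem_take cB; apply: BA.
have /choice[b hb] : forall i : 'I_n.+1, exists b : nat -> F,
    r s`_i = \sum_(j < n) b j *: e j.
  by move=> i; apply: sA; rewrite mem_nth // ss.
pose D : 'M[F]_(n.+1, n) := \matrix_(i, j) b i j.
have [v vn0 vD] : exists2 v : 'rV[F]_n.+1, v != 0 & v *m D = 0.
  have kn0 : kermx D != 0.
    by rewrite -mxrank_eq0 mxrank_ker subn_eq0 -ltnNge ltnS rank_leq_col.
  by have /rowV0Pn[v /sub_kermxP vD vn0] := kn0; exists v.
have dep : \sum_(i < n.+1) v 0 i *: r s`_i = 0.
  under eq_bigr => i _ do rewrite hb scaler_sumr.
  rewrite exchange_big big1 // => j _.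
  under eq_bigr => i _ do rewrite scalerA.
  rewrite -scaler_suml; have /rowP/(_ j) := vD; rewrite !mxE.
  by under eq_bigr => i _ do rewrite mxE; move=> ->; rewrite scale0r.
(* A common denominator: [y] is [p] divided by all the factors [theta - c], so each [r s_i] is the
   product of the other factors applied to [y]. The linear relation then becomes a polynomial in
   [theta] that kills [y]. *)
have [y Py yp] := act_prod_surj s Pp.
have yn0 : y <> 0.
  move=> y0; apply: pn0; rewrite -yp y0 /act big1 // => i _.
  by rewrite (_ : iter i theta 0 = 0) ?scaler0 //; elim: (i : nat) => //= k ->.
pose q (i : 'I_n.+1) := \prod_(c <- rem s`_i s) ('X - c%:P) : {poly F}.
have rq (i : 'I_n.+1) : r s`_i = act (q i) y.
  apply/eqP; rewrite -subr_eq0; apply/eqP.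
  have [Pr er] := hr s`_i; have Pq := act_in (q i) Py.
  apply: (@resolvent_inj s`_i); first exact: subspaceB.
  have -> : r s`_i - act (q i) y = (-1) *: act (q i) y + r s`_i.
    by rewrite scaleN1r addrC.
  rewrite theta_lin // scalerDr scalerA mulrC -scalerA opprD addrACA er.
  have prod_q : \prod_(c <- s) ('X - c%:P) = ('X - (s`_i)%:P) * q i.
    by rewrite (big_rem s`_i) ?mem_nth ?ss.
  by rewrite -scalerBr -act_XsubC // -prod_q yp scaleN1r addNr.
have [i0 vi0] : exists i0, v 0 i0 != 0.
  by apply/rV0Pn.
(* As in Lagrange interpolation, at the node [s_i0] every [q i] with [i <> i0] vanishes and [q i0]
   does not. *)
have qn0 : \sum_(i < n.+1) v 0 i *: q i != 0.
  apply/eqP => /(congr1 (fun f => f.[s`_i0])); rewrite horner0 horner_sum.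
  rewrite (bigD1 i0) //= big1 ?addr0 => [|i ii0].
    rewrite hornerZ => /eqP; rewrite mulf_eq0 (negPf vi0) /= -rootE root_prod_XsubC.
    by rewrite mem_rem_uniq // !inE eqxx.
  rewrite hornerZ; have /rootP -> : root (q i) s`_i0; last by rewrite mulr0.
  rewrite root_prod_XsubC mem_rem_uniq // inE mem_nth ?ss // andbT.
  by rewrite nth_uniq ?ss // eq_sym.
apply: (act_neq0 Py yn0 qn0); rewrite act_sum -[RHS]dep.
by apply: eq_bigr => i _; rewrite act_scale rq.
Qed.

End Schur.

(* Dixmier's argument: if theta were not scalar, all the resolvents
   (theta - c)^-1 p would exist, and they are linearly independent. *)
Lemma schur (F : numClosedFieldType) (M : lmodType F) (J : Type) (op : J -> M -> M)
    (P : set M) (e : nat -> M) (theta : M -> M) :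
  ~ countable [set: F] -> (forall j, linear (op j)) -> Defs.irreducible op P ->
  P `<=` lin_span (range e) -> (forall x, P x -> P (theta x)) ->
  (forall a x y, P x -> P y -> theta (a *: x + y) = a *: theta x + theta y) ->
  (forall j x, P x -> theta (op j x) = op j (theta x)) ->
  exists c, forall x, P x -> theta x = c *: x.
Proof.
move=> hF lop irrP eP tP tl tc; apply: contrapT => /forallNP h.
apply: (nonscalar_commutant_False hF lop irrP eP tP tl tc) => c.
apply: contrapT => hc; apply: (h c) => x Px; apply: contrapT => hx.
by apply: hc; exists x.
Qed.

(** * Invariant complements and equivariant projections *)

Section Projections.
Variables (F : numFieldType) (M : lmodType F) (J : Type) (op : J -> M -> M).
Hypothesis op_lin : forall j, linear (op j).

Lemma irreducible_gen (P T : set M) p : Defs.irreducible op P ->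
  Defs.invariant op T -> P p -> p <> 0 -> T p -> P `<=` T.
Proof.
move=> [iP _ mP] iT Pp pn0 Tp.
have [e|<-] := mP _ (invI iP iT) (@subIsetl _ _ _); last exact: subIsetr.
by have : (P `&` T) p by []; rewrite e.
Qed.

Definition is_projection (Z : set M) (rho : M -> M) :=
  [/\ linear rho, forall x, Z (rho x) & forall z, Z z -> rho z = z].

Lemma complement_projection Z : complemented op -> Defs.invariant op Z ->
  exists2 rho, is_projection Z rho & forall j x, rho (op j x) = op j (rho x).
Proof.
move=> compl iZ; have [T [iT ZT ZTT]] := compl _ iZ.
have [hZ hT] : subspace Z /\ subspace T by case: iZ; case: iT.
have /choice[rho hrho] : forall x, exists z, Z z /\ T (x - z).
  move=> x; have [z [t [Zz Tt ->]]] : sumS Z T x by rewrite ZTT.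
  by exists z; rewrite addrC addKr.
have uniq x z : Z z -> T (x - z) -> rho x = z.
  move=> Zz Tz; have [Zr Tr] := hrho x; apply/subr0_eq.
  suff: [set 0] (rho x - z) by [].
  rewrite -ZT; split; first exact: subspaceB.
  have -> : rho x - z = (x - z) - (x - rho x).
    by rewrite opprB [RHS]addrC addrA addrNK.
  exact: subspaceB.
exists rho.
  split=> [a x y|x|z Zz].
  - have [Zx Tx] := hrho x; have [Zy Ty] := hrho y.
    apply: uniq; first exact: hZ.2.
    rewrite opprD addrACA -scalerBr; exact: hT.2.
  - by case: (hrho x).
  - by apply: uniq => //; rewrite subrr; case: hT.
move=> j x; have [Zx Tx] := hrho x; apply: uniq; first exact: iZ.2.
by rewrite -linopB //; apply: iT.2.
Qed.

Lemma projection_complement Z rho : Defs.invariant op Z -> is_projection Z rho ->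
  (forall j x, rho (op j x) = op j (rho x)) ->
  exists T, [/\ Defs.invariant op T, Z `&` T = [set 0] & sumS Z T = setT].
Proof.
move=> iZ [lrho rZ rid] rcomm; exists [set x | rho x = 0]; split.
- split; last by move=> j x /= h; rewrite rcomm h linop0.
  split=> [|a x y] /=; first by rewrite linop0.
  by rewrite lrho => -> ->; rewrite scaler0 addr0.
- apply/seteqP; split=> x /=; first by move=> [/rid e h]; rewrite -e h.
  by move=> ->; rewrite linop0 //; split=> //; case: iZ => -[].
- apply/seteqP; split=> // x _; exists (rho x), (x - rho x); split=> //=.
    by rewrite linopB // [rho (rho x)]rid ?subrr.
  by rewrite addrC addrNK.
Qed.

End Projections.

(** * Joint semisimplicity of two commuting semisimple families *)

Section CommutingOperators.
Variables (F : numFieldType) (M : lmodType F) (JA JB : Type).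
Variables (opA : JA -> M -> M) (opB : JB -> M -> M).
Hypothesis linA : forall j, linear (opA j).
Hypothesis linB : forall j, linear (opB j).
Hypothesis commAB : forall i j x, opA i (opB j x) = opB j (opA i x).
Hypothesis complA : complemented opA.
Hypothesis spanA : spanned_by_irreducibles opA setT.
Hypothesis complB : complemented opB.

(** Homomorphisms out of [P] are represented by maps on all of [M], of which only the restriction to
    [P] matters. *)
Definition hom_on (P : set M) (f : M -> M) :=
  (forall a x y, P x -> P y -> f (a *: x + y) = a *: f x + f y) /\
  (forall j x, P x -> f (opA j x) = opA j (f x)).

Hypothesis schurA : forall P theta, Defs.irreducible opA P -> hom_on P theta ->
  (forall x, P x -> P (theta x)) -> exists c, forall x, P x -> theta x = c *: x.

Definition both (j : JA + JB) : M -> M :=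
  match j with inl i => opA i | inr i => opB i end.

Lemma both_lin j : linear (both j). Proof. by case: j. Qed.

Lemma inv_both (S : set M) : Defs.invariant both S <->
  Defs.invariant opA S /\ Defs.invariant opB S.
Proof.
split=> [[hS iS]|[[hS iA] [_ iB]]].
  by split; split=> // j x Sx; [apply: (iS (inl j))|apply: (iS (inr j))].
by split=> // -[j|j] x Sx; [apply: iA|apply: iB].
Qed.

Section HomSpace.
Variable P : set M.
Hypothesis irrP : Defs.irreducible opA P.

Let invP : Defs.invariant opA P. Proof. by case: irrP. Qed.
Let subP : subspace P. Proof. by case: invP. Qed.

Lemma hom_on0 f : hom_on P f -> f 0 = 0.
Proof.
move=> [lf _]; have P0 : P 0 by case: subP.
by have := lf (-1) _ _ P0 P0; rewrite scaler0 addr0 scaleN1r addNr.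
Qed.

Lemma inv_preimage f (T : set M) : hom_on P f -> Defs.invariant opA T ->
  Defs.invariant opA (P `&` f @^-1` T).
Proof.
move=> hf iT; split; last first.
  by move=> j x [Px Tx]; split; [apply: invP.2|rewrite /= hf.2 //; apply: iT.2].
split; first by split; [case: subP|rewrite /= hom_on0 //; case: iT => -[]].
move=> a x y [Px Tx] [Py Ty]; split; first exact: subP.2.
by rewrite /= hf.1 //; apply: iT.1.2.
Qed.

Lemma inv_image f : hom_on P f -> Defs.invariant opA (f @` P).
Proof.
move=> hf; split; last first.
  by move=> j _ [x Px <-]; exists (opA j x); [apply: invP.2|rewrite hf.2].
split; first by exists 0; [case: subP|rewrite hom_on0].
move=> a _ _ [x Px <-] [y Py <-]; exists (a *: x + y); first exact: subP.2.
by rewrite hf.1.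
Qed.

Lemma hom_on_comb a f g : hom_on P f -> hom_on P g ->
  hom_on P (fun x => a *: f x + g x).
Proof.
move=> hf hg; split=> [b x y Px Py|j x Px].
  by rewrite hf.1 // hg.1 // !scalerDr !scalerA mulrC addrACA.
by rewrite hf.2 // hg.2 // linA.
Qed.

Definition images (fs : seq (M -> M)) : set M :=
  foldr (fun f S => sumS (f @` P) S) [set 0] fs.

Definition all_in (H : set (M -> M)) (fs : seq (M -> M)) : Prop :=
  foldr (fun f Q => H f /\ Q) True fs.

Lemma all_in_cat H fs gs : all_in H (fs ++ gs) <-> all_in H fs /\ all_in H gs.
Proof. by elim: fs => [|f fs IH] /=; [tauto|rewrite /all_in /= -!/(all_in _ _) IH; tauto]. Qed.

Lemma inv_images fs : all_in (hom_on P) fs -> Defs.invariant opA (images fs).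
Proof.
elim: fs => [_|f fs IH [hf hfs]]; first exact: inv_set0.
by apply: inv_sumS => //; [exact: inv_image|exact: IH].
Qed.

Lemma images_cat fs gs : all_in (hom_on P) fs -> all_in (hom_on P) gs ->
  images (fs ++ gs) = sumS (images fs) (images gs).
Proof.
move=> hfs hgs; elim: fs hfs => [_|f fs IH [hf hfs]] /=.
  apply/seteqP; split=> x; first by move=> gx; exists 0, x; rewrite add0r.
  by move=> [_ [y [/= -> gy ->]]]; rewrite add0r.
rewrite /images /= -!/(images _) IH //; apply/seteqP; split=> x.
  move=> [u [_ [Pu [v [w [fv gw ->]]] ->]]]; exists (u + v), w; rewrite addrA.
  by split=> //; exists u, v.
move=> [_ [w [[u [v [Pu fv ->]]] gw ->]]]; exists u, (v + w); rewrite addrA.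
by split=> //; exists v, w.
Qed.

Variable H : set (M -> M).
Hypothesis H_hom : forall f, H f -> hom_on P f.
Hypothesis H0 : H (fun=> 0).
Hypothesis H_comb : forall a f g, H f -> H g -> H (fun x => a *: f x + g x).

Lemma all_in_hom fs : all_in H fs -> all_in (hom_on P) fs.
Proof. by elim: fs => //= f fs IH [hf /IH]; split=> //; apply: H_hom. Qed.

(* Schur's lemma: Hom(P, f_1 P + ... + f_n P) is spanned by f_1, ..., f_n. *)
Lemma hom_to_images fs eta : all_in H fs -> hom_on P eta ->
  (forall x, P x -> images fs (eta x)) ->
  exists2 g, H g & forall x, P x -> eta x = g x.
Proof.
elim: fs eta => [|f fs IH] eta.
  by move=> _ _ h; exists (fun=> 0) => // x /h.
move=> [Hf Hfs] heta h; have hf := H_hom Hf.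
have iY := inv_images (all_in_hom Hfs).
have hY : subspace (images fs) by case: iY.
have iK := inv_preimage hf iY.
(* Either [f] is injective modulo the remaining images, or its image already lies in them. *)
have [K0|KP] := irreducible_dichotomy irrP iK (@subIsetl _ _ _); last first.
  apply: IH => // x Px; apply: sumS_min (h x Px) => // _ [y Py <-].
  by have [] := KP _ Py.
have K_inj x : P x -> images fs (f x) -> x = 0.
  by move=> Px Yx; have : (P `&` f @^-1` images fs) x by []; rewrite K0.
(* [theta] solves [eta = f theta] modulo the remaining images. Injectivity of [f] there makes it a
   well-defined endomorphism of [P], hence a scalar [c], and [eta - c f] takes values in the
   remaining images. *)
have /choice[theta htheta] : forall x, exists y,
    P x -> P y /\ images fs (eta x - f y).
  move=> x; have [Px|] := pselect (P x); last by exists 0.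
  have [_ [z [[y Py <-] Yz ez]]] := h x Px.
  by exists y; rewrite ez addrC addKr.
have theta_uniq x y : P x -> P y -> images fs (eta x - f y) -> theta x = y.
  move=> Px Py Yy; have [Pt Yt] := htheta x Px.
  apply/subr0_eq; rewrite -scaleN1r addrC.
  apply: K_inj; first exact: subP.2.
  rewrite hf.1 // scaleN1r addrC.
  have -> : f (theta x) - f y = (eta x - f y) - (eta x - f (theta x)).
    by rewrite opprB [RHS]addrC addrA addrNK.
  exact: subspaceB.
have [||c hc] := schurA (theta := theta) irrP.
- split=> [a x y Px Py|j x Px].
    have [Ptx Ytx] := htheta x Px; have [Pty Yty] := htheta y Py.
    apply: theta_uniq; [exact: subP.2|exact: subP.2|].
    rewrite hf.1 // heta.1 // opprD addrACA -scalerBr; exact: hY.2.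
  have [Ptx Ytx] := htheta x Px.
  apply: theta_uniq; [exact: invP.2|exact: invP.2|].
  by rewrite hf.2 // heta.2 // -linopB //; apply: iY.2.
- by move=> x /htheta [].
have [//|||g Hg eg] := IH (fun x => (- c) *: f x + eta x).
- exact: hom_on_comb.
- move=> x Px; have [Ptx Ytx] := htheta x Px.
  rewrite scaleNr addrC; suff <- : f (theta x) = c *: f x by [].
  have P0 : P 0 by case: subP.
  by rewrite hc // -[c *: x]addr0 hf.1 // hom_on0 // addr0.
exists (fun x => c *: f x + g x); first exact: H_comb.
by move=> x Px; rewrite -eg // addrA scaleNr subrr add0r.
Qed.

End HomSpace.

(** [X] plays the role of [P (x) Q]: the maps in [H] correspond to the vectors of [Q] by evaluation
    at [p]. For an invariant [Z] inside [X], take an [opA]-linear projection [rho] onto [Z]. If it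
    kills every [f p], then [Z = 0]. Otherwise some nonzero [rho f] agrees on [P] with a member of
    [H] by Schur's lemma; so [Z] meets [Q] nontrivially, hence contains [Q], and with it [X]. *)
Lemma tensor_irreducible P p Q : Defs.irreducible opA P -> P p -> p <> 0 ->
  Defs.irreducible opB Q ->
  (forall q, Q q -> exists2 f, hom_on P f & q = f p) ->
  exists2 X, Defs.irreducible both X & Q `<=` X.
Proof.
move=> irrP Pp pn0 irrQ QE.
pose H f := hom_on P f /\ Q (f p).
have hQ : subspace Q by case: irrQ => -[].
have H_hom f : H f -> hom_on P f by case.
have H0 : H (fun=> 0).
  by split; [split=> [a x y|j x] _; rewrite ?scaler0 ?addr0 ?linop0|case: hQ].
have H_comb a f g : H f -> H g -> H (fun x => a *: f x + g x).
  by move=> [hf Qf] [hg Qg]; split; [exact: hom_on_comb|exact: hQ.2].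
pose X := lin_span [set x | exists f y, [/\ H f, P y & x = f y]].
have QX : Q `<=` X.
  move=> q Qq; have [f hf qf] := QE q Qq; apply: sub_lin_span; exists f, p.
  by split=> //; split=> //; rewrite -qf.
have iX : Defs.invariant both X.
  apply: inv_span; first exact: both_lin.
  move=> [j|j] _ [f [y [[hf Qf] Py ->]]]; apply: sub_lin_span.
    exists f, (opA j y); split=> //; last by rewrite hf.2.
    by case: irrP => -[_ h] _ _; apply: h.
  exists (opB j \o f), y; split=> //; split; last first.
    by case: irrQ => -[_ h] _ _; apply: h.
  split=> [a x z Px Pz|i x Px] /=; first by rewrite hf.1 // linB.
  by rewrite hf.2 // commAB.
exists X => //; split=> //.
  move=> X0; have [_ Qn0 _] := irrQ; apply: Qn0; apply: sub_set0 => //.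
  by rewrite -X0.
move=> Z /inv_both[iZA iZB] ZX.
have [rho [lrho rhoZ rho_id] rho_comm] := complement_projection linA complA iZA.
have [[f [Hf rfn0]]|none] := pselect (exists f, H f /\ rho (f p) <> 0); last first.
  left; apply: sub_set0; first by case: iZA.
  move=> z Zz /=; rewrite -(rho_id z Zz).
  have ik : Defs.invariant opA [set x | rho x = 0].
    split; last by move=> j x /= h; rewrite rho_comm h linop0.
    split=> [|a x y] /=; first by rewrite linop0.
    by rewrite lrho => -> ->; rewrite scaler0 addr0.
  apply: (lin_span_min (S := [set x | rho x = 0]) _ _ (ZX _ Zz)).
    by case: ik.
  move=> _ [f [y [Hf Py ->]]].
  have := irreducible_gen irrP (inv_preimage irrP (H_hom _ Hf) ik) Pp pn0.
  move=> /(_ _ _ Py) [] //; split=> //=.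
  by apply: contrapT => rfn0; apply: none; exists f.
right; apply/seteqP; split=> // .
have X_images x : X x -> exists2 fs, all_in H fs & images P fs x.
  move: x; apply: lin_span_min.
    split; first by exists [::].
    move=> a x y [fs Hfs fx] [gs Hgs gy]; exists (fs ++ gs).
      by apply/all_in_cat.
    have hfs := all_in_hom H_hom Hfs; have hgs := all_in_hom H_hom Hgs.
    rewrite images_cat //; exists (a *: x), y; split=> //.
    by apply: subspaceZ => //; case: (inv_images irrP hfs).
  move=> _ [g [y [Hg Py ->]]]; exists [:: g] => //=.
  by exists (g y), 0; rewrite addr0; split=> //; exists y.
have hrf : hom_on P (rho \o f).
  have hf := H_hom _ Hf; split=> [a x y Px Py|j x Px] /=.
    by rewrite hf.1 // lrho.
  by rewrite hf.2 // rho_comm.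
have [fs Hfs fsx] := X_images _ (ZX _ (rhoZ (f p))).
have iim := inv_images irrP (all_in_hom H_hom Hfs).
have [|g [hg Qg] eg] := hom_to_images irrP H_hom H0 H_comb Hfs hrf.
  move=> x Px; have := irreducible_gen irrP (inv_preimage irrP hrf iim) Pp pn0.
  by move=> /(_ _ _ Px) [].
have QZ : Q `<=` Z.
  have egp : rho (f p) = g p by apply: eg.
  by apply: (irreducible_gen irrQ iZB Qg); rewrite -egp.
apply: lin_span_min; first by case: iZA.
move=> _ [f' [y [[hf' Qf'] Py ->]]].
have := irreducible_gen irrP (inv_preimage irrP hf' iZA) Pp pn0.
by move=> /(_ _ _ Py) [] //; split=> //=; apply: QZ.
Qed.

(** For [p] in an [opA]-irreducible [P], the values [f p] of all homomorphisms [f] out of [P] form a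
    space stable under [opB], because the families commute. It contains [p] (take [f = id]) and is a
    sum of [opB]-irreducibles, each of which sits in a jointly irreducible space. *)
Theorem both_spanned : spanned_by_irreducibles both setT.
Proof.
rewrite /spanned_by_irreducibles; set Soc := lin_span _.
have hSoc : subspace Soc by apply: lin_span_subspace.
move=> x /spanA; apply: lin_span_min => // p [P [irrP _] Pp].
have [->|/eqP pn0] := eqVneq p 0; first by case: hSoc.
pose E := [set q | exists2 f, hom_on P f & q = f p].
have iE : Defs.invariant opB E.
  split; first split.
  - by exists (fun=> 0) => //; split=> [a y z|j y] _; rewrite ?scaler0 ?addr0 ?linop0.
  - move=> a _ _ [f hf ->] [g hg ->]; exists (fun x => a *: f x + g x) => //.
    exact: hom_on_comb.
  - move=> j _ [f hf ->]; exists (opB j \o f) => //.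
    split=> [a y z Py Pz|i y Py] /=; first by rewrite hf.1 // linB.
    by rewrite hf.2 // commAB.
have Ep : E p by exists id.
apply: lin_span_min (complemented_spanned linB complB iE Ep) => //.
move=> q [Q [irrQ QE] Qq].
have [X irrX QX] := tensor_irreducible irrP Pp pn0 irrQ QE.
by apply: sub_lin_span; exists X; [split|apply: QX].
Qed.

End CommutingOperators.

(** * Mode identities extracted from the Jacobi identity *)

Section Modes.
Variables (F : numFieldType) (V : voa F) (M : weak_module V).
Implicit Types (u v : V) (w x y : M) (l m n p q k : int).

Lemma fsum_nat (X : lmodType F) (f : nat -> X) N :
  (forall i, (N <= i)%N -> f i = 0) ->
  \sum_(i \in [set: nat]) f i = \sum_(i < N) f i.
Proof.
move=> f0; rewrite fsbig_ord; apply/esym/fsbig_widen => // i /= [_ /negP].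
by rewrite -leqNgt; apply: f0.
Qed.

Lemma YM_linl n w : linear (fun u => YM M u n w).
Proof. by case: (YM_operators M). Qed.

Lemma Y_linl n v : linear (fun u => Y V u n v).
Proof. by case: (Y_operators V). Qed.

Lemma Y_linr u n : linear (Y V u n).
Proof. by case: (Y_operators V). Qed.

Lemma YM0l n w : YM M 0 n w = 0.
Proof. exact: linop0 (YM_linl n w). Qed.

Lemma YMZl a u n w : YM M (a *: u) n w = a *: YM M u n w.
Proof. exact: linopZ (YM_linl n w) a u. Qed.

Lemma YM0r u n : YM M u n 0 = 0.
Proof. exact: linop0 (YM_lin u n). Qed.

Lemma binz0 m : binz F m 0 = 1.
Proof. by rewrite /binz big_ord0 divr1. Qed.

Lemma binzS m i : binz F m i.+1 * i.+1%:R = binz F m i * (m - i%:Z)%:~R.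
Proof.
rewrite /binz big_ord_recr /= factS natrM.
have i0 : i.+1%:R != 0 :> F by rewrite pnatr_eq0.
have f0 : i`!%:R != 0 :> F by rewrite pnatr_eq0 -lt0n fact_gt0.
by rewrite invfM (mulrC i.+1%:R^-1) mulrA mulfVK // mulrAC.
Qed.

Lemma binz_eq0 i j : (i < j)%N -> binz F i j = 0.
Proof.
move=> ij; rewrite /binz (bigD1 (Ordinal ij)) //= subrr.
by rewrite mulr0z mul0r mul0r.
Qed.

Lemma truncated u w : exists B : int, forall n, B <= n -> YM M u n w = 0.
Proof. by case: (YM_operators M). Qed.

Lemma truncated_shift (X : lmodType F) (f : int -> X) m :
  (exists B, forall n, B <= n -> f n = 0) ->
  exists B : nat, forall i : nat, (B <= i)%N -> f (m + i%:Z) = 0.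
Proof.
move=> [B hB]; exists `|B - m|%N => i Bi; apply: hB.
by rewrite -lerBlDl (le_trans (ler_norm _)) // -abszE lez_nat.
Qed.

Lemma jacobi_truncated u v w l m n : exists B : nat, forall N, (B <= N)%N ->
  \sum_(i < N) binz F m i *: YM M (Y V u (l + i%:Z) v) (m + n - i%:Z) w =
  \sum_(i < N) ((-1) ^+ i * binz F l i) *:
     (YM M u (m + l - i%:Z) (YM M v (n + i%:Z) w)
      - ((-1) ^ l) *: YM M v (n + l - i%:Z) (YM M u (m + i%:Z) w)).
Proof.
have [_ _ truncV] := Y_operators V.
have [B1 /= h1] := truncated_shift l (truncV u v).
have [B2 /= h2] := truncated_shift n (truncated v w).
have [B3 /= h3] := truncated_shift m (truncated u w).
exists (maxn B1 (maxn B2 B3)) => N; rewrite !geq_max => /and3P[N1 N2 N3].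
have := YM_jacobi u v w l m n; rewrite (@fsum_nat _ _ N) => [->|i Ni].
  rewrite (@fsum_nat _ _ N) // => i Ni.
  by rewrite h2 ?h3 ?(leq_trans _ Ni) // !YM0r scaler0 subr0 scaler0.
by rewrite h1 ?(leq_trans _ Ni) // YM0l scaler0.
Qed.

(** Associativity: once [m] is past the truncation of [u] on [w], the terms in which [u] acts first
    vanish and only products in the order [u v] remain. *)
Lemma jacobi_ordered u v w l m n : (forall k, m <= k -> YM M u k w = 0) ->
  exists B : nat, forall N, (B <= N)%N ->
  \sum_(i < N) binz F m i *: YM M (Y V u (l + i%:Z) v) (m + n - i%:Z) w =
  \sum_(i < N) ((-1) ^+ i * binz F l i) *:
     YM M u (m + l - i%:Z) (YM M v (n + i%:Z) w).
Proof.
move=> um; have [B hB] := jacobi_truncated u v w l m n.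
exists B => N BN; rewrite hB //; apply: eq_bigr => i _.
by rewrite um ?lerDl // YM0r scaler0 subr0.
Qed.

Lemma commutator u v w m n : exists B : nat, forall N, (B <= N)%N ->
  YM M u m (YM M v n w) - YM M v n (YM M u m w) =
  \sum_(i < N) binz F m i *: YM M (Y V u i v) (m + n - i%:Z) w.
Proof.
have [B hB] := jacobi_truncated u v w 0 m n; exists B.+1 => N BN.
under eq_bigr => i _ do rewrite -[i%:Z]add0r.
rewrite hB; last exact: ltnW.
case: N BN => // N _; rewrite big_ord_recl big1 ?addr0 => [|i _].
  by rewrite /= binz0 mulr1 expr0 expr0z !scale1r.
by rewrite binz_eq0 // mulr0 scale0r.
Qed.

Lemma modes_commute u v w m n : (forall i : nat, Y V u i v = 0) ->
  YM M u m (YM M v n w) = YM M v n (YM M u m w).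
Proof.
move=> uv; apply/subr0_eq; have [B hB] := commutator u v w m n.
by rewrite (hB B) // big1 // => i _; rewrite uv YM0l scaler0.
Qed.

Lemma int_downward (P : int -> Prop) (B : int) :
  (forall n, B <= n -> P n) ->
  (forall n, (forall k : nat, P (n + k.+1%:Z)) -> P n) -> forall n, P n.
Proof.
move=> PB Pdown n.
suff h : forall (d : nat) n, B <= n + d%:Z -> P n.
  apply: (h `|B - n|%N); rewrite -lerBlDl; exact: ler_norm.
elim=> [|d IH] k hk; first by apply: PB; rewrite addr0 in hk.
apply: Pdown => j; apply: IH; apply: le_trans hk _.
by rewrite -addrA lerD2l -PoszD lez_nat addSnnS leq_addl.
Qed.

(* The products v_p u_n act on x and y through the same finite linear
   combination of modes (v_k u)_l: for m large, the Jacobi identity is a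
   triangular system expressing the former through the latter. *)
Lemma product_of_modes (G : M -> M -> Prop) u v x y :
  G 0 0 ->
  (forall a z t z' t', G z t -> G z' t' -> G (a *: z + z') (a *: t + t')) ->
  (forall k l, G (YM M (Y V v k u) l x) (YM M (Y V v k u) l y)) ->
  forall p n, G (YM M v p (YM M u n x)) (YM M v p (YM M u n y)).
Proof.
move=> G0 Gcomb Gmodes p n; move: n p.
have Gsum N (c : 'I_N -> F) (f g : 'I_N -> M) : (forall i, G (f i) (g i)) ->
    G (\sum_(i < N) c i *: f i) (\sum_(i < N) c i *: g i).
  move=> fg; pose R z t := G z t; rewrite -/(R _ _).
  by elim/big_rec2: _ => // i z t _; apply: Gcomb.
have [m1 um1] := truncated v x; have [m2 um2] := truncated v y.
have [K1 uK1] := truncated u x; have [K2 uK2] := truncated u y.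
(* One [m] for both vectors gives the two systems the same coefficients. In each, the term [i = 0]
   is [v_p u_n] and the others carry [u_(n+i)] with [i > 0], whence the downward induction on
   [n]. *)
pose m := Num.max m1 m2.
have umx k : m <= k -> YM M v k x = 0 by rewrite ge_max => /andP[/um1].
have umy k : m <= k -> YM M v k y = 0 by rewrite ge_max => /andP[_ /um2].
apply: (@int_downward _ (Num.max K1 K2)).
  by move=> n; rewrite ge_max => /andP[/uK1 -> /uK2 ->] p; rewrite YM0r.
move=> n IH p.
have [B1 h1] := @jacobi_ordered v u x (p - m) m n umx.
have [B2 h2] := @jacobi_ordered v u y (p - m) m n umy.
pose N := maxn B1 B2.
have {}h1 := h1 N.+1 (leqW (leq_maxl _ _)).
have {}h2 := h2 N.+1 (leqW (leq_maxr _ _)).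
rewrite [RHS]big_ord_recl /= in h1; rewrite [RHS]big_ord_recl /= in h2.
have emp : m + (p - m) = p by rewrite addrC subrK.
rewrite expr0 binz0 mulr1 scale1r ?addr0 ?subr0 emp in h1.
rewrite expr0 binz0 mulr1 scale1r ?addr0 ?subr0 emp in h2.
have -> : YM M v p (YM M u n x) =
    (-1) *: (\sum_(i < N) ((-1) ^+ (lift ord0 i) * binz F (p - m) (lift ord0 i)) *:
      YM M v (p - (lift ord0 i)%:Z) (YM M u (n + (lift ord0 i)%:Z) x)) +
    \sum_(i < N.+1) binz F m i *: YM M (Y V v (p - m + i%:Z) u) (m + n - i%:Z) x.
  by rewrite h1 scaleN1r addrC addrK.
have -> : YM M v p (YM M u n y) =
    (-1) *: (\sum_(i < N) ((-1) ^+ (lift ord0 i) * binz F (p - m) (lift ord0 i)) *: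
      YM M v (p - (lift ord0 i)%:Z) (YM M u (n + (lift ord0 i)%:Z) y)) +
    \sum_(i < N.+1) binz F m i *: YM M (Y V v (p - m + i%:Z) u) (m + n - i%:Z) y.
  by rewrite h2 scaleN1r addrC addrK.
by apply: Gcomb; apply: Gsum => i; [apply: IH|apply: Gmodes].
Qed.

Lemma product_of_modes_in (S : set M) u v x : subspace S ->
  (forall k l, S (YM M (Y V v k u) l x)) ->
  forall p n, S (YM M v p (YM M u n x)).
Proof.
move=> hS Smodes; apply: (product_of_modes (G := fun z _ => S z) (y := x)) => //.
  by case: hS.
by move=> a z _ z' _; apply: hS.2.
Qed.

Lemma product_of_modes_intertwined (rho : M -> M) u v x y : linear rho ->
  (forall k l, YM M (Y V v k u) l y = rho (YM M (Y V v k u) l x)) ->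
  forall p n, YM M v p (YM M u n y) = rho (YM M v p (YM M u n x)).
Proof.
move=> lrho; apply: (product_of_modes (G := fun z t => t = rho z)).
  by rewrite linop0.
by move=> a z t z' t' -> ->; rewrite lrho.
Qed.

(** The triangular system solved the other way: on the left the term [i = 0] is [(u_l v)_n x] and
    the others involve [u_(l+i) v] with [i > 0], so the induction descends in [l]. *)
Lemma mode_of_product (S : set M) u v x : subspace S ->
  (forall p q, S (YM M u p (YM M v q x))) ->
  forall l n, S (YM M (Y V u l v) n x).
Proof.
move=> hS Suv; have [B hB] : exists B : int, forall l, B <= l -> Y V u l v = 0.
  by case: (Y_operators V).
have [m um] := truncated u x.
apply: (@int_downward _ B) => [l /hB -> n|l IH n].
  by rewrite YM0l; case: hS.
have [B' h] := @jacobi_ordered u v x l m (n - m) um.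
have {h} := h B'.+1 (leqW (leqnn _)).
have emn : m + (n - m) = n by rewrite addrC subrK.
rewrite [LHS]big_ord_recl /= binz0 scale1r ?addr0 ?subr0 emn.
move=> /(canRL (addrK _)) ->; apply: (subspaceB hS); apply: subspace_sum => // i _.
  by apply: subspaceZ => //; apply: Suv.
by apply: subspaceZ => //; apply: IH.
Qed.

(** These are the coefficients of [(1 - x)^(-2)]; they arise from the mode [u_(-2)] in the
    derivative formula. *)
Lemma sign_binzN2 i : (-1) ^+ i * binz F (-2) i = i.+1%:R.
Proof.
elim: i => [|i IH]; first by rewrite binz0 mulr1.
have i0 : i.+1%:R != 0 :> F by rewrite pnatr_eq0.
apply: (mulIf i0).
have -> : (-1) ^+ i.+1 * binz F (-2) i.+1 * i.+1%:R =
    - ((-1) ^+ i * binz F (-2) i) * (-2 - i%:Z)%:~R.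
  by rewrite exprS mulN1r -mulrA binzS mulrA !mulNr.
have -> : (-2 - i%:Z)%:~R = - i.+2%:R :> F.
  by rewrite (pmulrn 1 i.+2) -mulrNz; congr (_%:~R); lia.
by rewrite IH mulrNN mulrC.
Qed.

Lemma vacYM n w : YM M (vac V) n w = if n == -1 then w else 0.
Proof. exact: YM_vacuum. Qed.

(** As [u_(-2) 1] is [L(-1) u], this is the derivative property on modules. It comes from the Jacobi
    identity with the vacuum as second vector, [l = -2] and [m = 0]. *)
Lemma module_derivative u n w : YM M (Y V u (-2) (vac V)) n w = - n%:~R *: YM M u (n - 1) w.
Proof.
have [B h] := jacobi_truncated u (vac V) w (-2) 0 n.
have {h} := h (B + `|n|).+1 (leqW (leq_addr _ _)).
rewrite big_ord_recl /= binz0 scale1r big1 => [|i _]; last first.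
  by rewrite binz_eq0 // scale0r.
rewrite addr0 ?add0r ?subr0 ?addr0 => ->.
have sgn : (-1 : F) ^ (-2) = 1.
  by rewrite -[LHS]/(((-1) ^+ 2)^-1) sqrrN expr1n invr1.
under eq_bigr => i _ do rewrite sign_binzN2 !vacYM add0r sgn scale1r.
have N1 (a : int) : a <> -1 -> (a == -1) = false by move=> h; apply/negP => /eqP.
(* At most one summand survives: index [n - 1], from the second product, if [n > 0], and index
   [-n - 1], from the first, if [n < 0]. The summation bound was enlarged by the absolute value of
   [n] to include it. *)
case: n => [[|n]|n].
- rewrite oppr0 scale0r big1 // => i _.
  by rewrite !N1 ?YM0r ?subr0 ?scaler0 //; lia.
- have hn : (n < (B + `|n.+1|).+1)%N by lia.
  rewrite (bigD1 (Ordinal hn)) //= big1 ?addr0 => [|i /eqP ni].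
    have -> : n.+1%:Z - 2 - n%:Z = -1 by lia.
    have -> : n.+1%:Z - 1 = n by lia.
    by rewrite YM0r sub0r scalerN scaleNr.
  have ni' : i <> n :> nat by move=> e; apply: ni; apply: val_inj.
  by rewrite !N1 ?YM0r ?subr0 ?scaler0 //; lia.
- have hn : (n < (B + `|Negz n|).+1)%N by lia.
  rewrite (bigD1 (Ordinal hn)) //= big1 ?addr0 => [|i /eqP ni].
    rewrite (N1 (_ - _ - _)); last by lia.
    have -> : Negz n + n%:Z = -1 by lia.
    have -> : Negz n - 1 = -2 - n%:Z by lia.
    by rewrite subr0 eqxx NegzE mulrNz opprK.
  have ni' : i <> n :> nat by move=> e; apply: ni; apply: val_inj.
  by rewrite !N1 ?YM0r ?subr0 ?scaler0 //; lia.
Qed.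

End Modes.

Definition modes (F : numFieldType) (V : voa F) (M : weak_module V)
  (p : V * int) : M -> M := YM M p.1 p.2.

Arguments modes {F V} M p _.

(** * Weights and commutators with L(0) *)

Section Weights.
Variables (F : numFieldType) (V : voa F).

Lemma modes_lin (M : weak_module V) p : linear (modes M p).
Proof. exact: YM_lin. Qed.

Lemma weight_ind (S : set V) : subspace S ->
  (forall k u, weight k u -> S u) -> forall u, S u.
Proof. exact: (ds_ind (wt_direct_sum V)). Qed.

Lemma omega_mode0 u : Y V (omega V) 0 u = Y V u (-2) (vac V).
Proof.
have := Y_derivative u (-1) (vac V); rewrite (Y_creation _).1 => ->.
by rewrite mulrNz opprK scale1r.
Qed.

(** Apply [[L(0), L(-2)] = 2 L(-2)] to the vacuum, which [L(0)] kills and [L(-2)] sends to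
    [omega]. *)
Lemma omega_weight : weight 2 (omega V).
Proof.
rewrite /weight /=; have := @Y_virasoro F V 0 (-2) (vac V) I; cbv beta.
have -> : (0 - 2 == 0 :> int) = false by [].
rewrite scale0r addr0 !add0r; have -> : -2 + 1 = -1 :> int by [].
by rewrite !(Y_creation _).1 (Y_creation _).2 // (linop0 (Y_linr _ _)) subr0 opprK.
Qed.

(** Only [omega_0 u = L(-1) u] and [omega_1 u = k u] enter the commutator of [omega_1]; they
    contribute [-(n + 1)] and [k]. *)
Lemma omega_commutator (M : weak_module V) k u n (w : M) : weight k u ->
  YM M (omega V) 1 (YM M u n w) =
  YM M u n (YM M (omega V) 1 w) + (k - n - 1)%:~R *: YM M u n w.
Proof.
move=> wu; have [B h] := commutator (omega V) u w 1 n.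
have {h} := h B.+2 (leqW (leqW (leqnn _))).
rewrite 2!big_ord_recl /= big1 => [|i _]; last by rewrite (binz_eq0 F (i := 1)) // scale0r.
have b11 : binz F 1 1 = 1.
  by rewrite -[LHS]mulr1 -[X in _ * X]/(1%:R) binzS binz0 subr0 mul1r.
rewrite (_ : bump 0 0 = 1%N) // b11 binz0 !scale1r ?addr0 ?subr0.
rewrite addrAC subrr add0r => /(canRL (subrK _)) ->.
rewrite addrC; congr (_ + _); rewrite omega_mode0 module_derivative.
rewrite (_ : Y V (omega V) 1 u = k%:~R *: u) // YMZl.
have -> : 1 + n - 1 = n by lia.
rewrite -scalerDl -mulrNz -intrD; congr (_%:~R *: _); lia.
Qed.

End Weights.

(** * Submodules generated by one vector *)

Section IrreducibleModules.
Variables (F : numFieldType) (V : voa F).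

(** A product of two modes applied to [p] is again a combination of single modes applied to [p], so
    iterated products generate nothing new. *)
Lemma modes_span_invariant (M : weak_module V) (p : M) :
  Defs.invariant (modes M) (lin_span [set x | exists u n, x = YM M u n p]).
Proof.
apply: inv_span; first exact: modes_lin.
move=> [u n] _ [v [m ->]] /=; apply: product_of_modes_in.
  exact: lin_span_subspace.
by move=> k l; apply: sub_lin_span; exists (Y V u k v), l.
Qed.

Lemma modes_span_id (M : weak_module V) (p : M) :
  lin_span [set x | exists u n, x = YM M u n p] p.
Proof. by apply: sub_lin_span; exists (vac V), (-1); rewrite vacYM. Qed.

(** Finite-dimensional weight spaces leave countably many triples of a weight, an index in a
    spanning list and a mode. This is the countability that Schur's lemma requires. *)
Lemma modes_span_countable (M : weak_module V) (p : M) : exists e : nat -> M,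
  lin_span [set x | exists u n, x = YM M u n p] `<=` lin_span (range e).
Proof.
have /choice[s hs] : forall k, exists s : seq V, weight k `<=` lin_span [set` s].
  by move=> k; apply: wt_finite_dim.
pose e j := if (choice.unpickle j : option (int * nat * int)) is Some (k, i, n)
  then YM M (nth 0 (s k) i) n p else 0.
exists e; apply: lin_span_min; first exact: lin_span_subspace.
have hE := lin_span_subspace (range e).
move=> _ [u [n ->]]; move: u.
have sub_mode : subspace [set u : V | lin_span (range e) (YM M u n p)].
  split=> [|a u v hu hv] /=; first by rewrite YM0l; case: hE.
  by rewrite YM_linl; apply: hE.2.
apply: (weight_ind sub_mode) => k u /hs; apply: lin_span_min => // v /= vs.
apply: sub_lin_span; exists (choice.pickle (k, index v (s k), n)) => //.
by rewrite /e choice.pickleK nth_index.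
Qed.

Lemma irreducible_countable (M : weak_module V) (P : set M) :
  Defs.irreducible (modes M) P -> exists e : nat -> M, P `<=` lin_span (range e).
Proof.
move=> irrP; have [p Pp pn0] : exists2 p, P p & p <> 0.
  by apply: nonzero_subspace; case: irrP => // -[].
have [e he] := modes_span_countable p; exists e; apply: subset_trans he.
exact: (irreducible_gen irrP (modes_span_invariant p) Pp pn0 (modes_span_id p)).
Qed.

End IrreducibleModules.

(** * The degree operator, and L(0) minus the degree *)

Section Graded.
Variables (F : numFieldType) (V : voa F) (M : admissible_module V).
Local Notation pi := (component (deg M)).
Let dM := deg_direct_sum M.

Lemma int_graded_component n j x : int_graded 0 (deg M) j x ->
  pi n x = (if j == n%:Z then x else 0).
Proof.
case: j => [j|j] /=; last by move=> ->; rewrite linop0 //; apply: component_lin.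
move=> jx; case: eqP => [[<-]|jn]; first exact: component_id.
by apply: (component_other dM jx) => e; apply: jn; rewrite e.
Qed.

Lemma mode_span_graded n0 (p : M) : deg M n0 p ->
  Defs.invariant (@modes_and_degrees _ _ M)
    (lin_span [set x | exists u n, x = YM M u n p]).
Proof.
move=> np; set X := lin_span _; have [hX iX] := modes_span_invariant p.
split=> // -[q|N] x Xx /=; first exact: (iX q).
apply: (lin_span_min (S := [set x | X (pi N x)]) _ _ Xx).
  split=> [|a y z hy hz] /=; first by rewrite linop0; [case: hX|apply: component_lin].
  by rewrite component_lin //; apply: hX.2.
move=> _ [u [n ->]] /=; move: u; apply: weight_ind.
  split=> [|a u v hu hv] /=.
    by rewrite YM0l linop0; [case: hX|apply: component_lin].
  by rewrite YM_linl component_lin //; apply: hX.2.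
move=> k u wu; rewrite (int_graded_component _ (deg_compat wu n np)).
by case: ifP => _; [apply: sub_lin_span; exists u, n|case: hX].
Qed.

Lemma graded_irreducible_countable (P : set M) :
  Defs.irreducible (@modes_and_degrees _ _ M) P ->
  exists e : nat -> M, P `<=` lin_span (range e).
Proof.
move=> irrP; have [[hP iP] _ _] := irrP.
have [x Px xn0] : exists2 p, P p & p <> 0.
  by apply: nonzero_subspace => //; case: irrP.
have [n pn0] : exists n, pi n x <> 0.
  apply: contrapT => /forallNP h; apply: xn0; apply: (component_ext dM) => n.
  by rewrite linop0; [apply: contrapT; apply: h|apply: component_lin].
have [e he] := modes_span_countable (pi n x); exists e; apply: subset_trans he.
have np := component_in dM n x.
exact: (irreducible_gen irrP (mode_span_graded np) (iP (inr n) _ Px) pn0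
  (modes_span_id _)).
Qed.

Lemma degree_operator : exists D : M -> M, forall n x, pi n (D x) = n%:R *: pi n x.
Proof.
suff /choice[D hD] : forall x, exists y, forall n, pi n y = n%:R *: pi n x.
  by exists D.
move=> x; have [B hB] := component_bound dM x.
apply: (glue dM (B := B)) => n; last by move=> /hB ->; rewrite scaler0.
by apply: subspaceZ; [apply: ds_subspace|apply: component_in].
Qed.

Variable D : M -> M.
Hypothesis hD : forall n x, pi n (D x) = n%:R *: pi n x.

Lemma degree_lin : linear D.
Proof.
move=> a x y; apply: (component_ext dM) => n.
by rewrite component_lin // !hD component_lin // scalerDr !scalerA mulrC.
Qed.

Lemma degreeE j x : int_graded 0 (deg M) j x -> D x = j%:~R *: x.
Proof.
move=> jx; apply: (component_ext dM) => n.
rewrite hD (linopZ (component_lin dM n)) (int_graded_component _ jx).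
by case: eqP => [->|_]; rewrite ?scaler0 // pmulrn.
Qed.

Lemma degree_commutator k u n x : weight k u ->
  D (YM M u n x) = YM M u n (D x) + (k - n - 1)%:~R *: YM M u n x.
Proof.
move=> wu; move: x; apply: (ds_ext dM) => [a x y|a x y|m x mx].
- by rewrite YM_lin degree_lin.
- by rewrite degree_lin !YM_lin !scalerDr addrACA !scalerA mulrC.
rewrite (degreeE (deg_compat wu n mx)) (degreeE (j := m%:Z) mx).
rewrite (linopZ (YM_lin _ _)) -scalerDl -intrD; congr (_%:~R *: _); lia.
Qed.

Definition energy x := YM M (omega V) 1 x - D x.

Lemma energy_lin : linear energy.
Proof. by move=> a x y; rewrite /energy YM_lin degree_lin opprD addrACA scalerBr. Qed.

(** [L(0)] and the degree have the same commutator [(k - n - 1) u_n] with [u_n] for [u] of weight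
    [k]. Degree projections commute with [L(0)] because [omega] has weight 2, so that [omega_1]
    preserves degrees. *)
Lemma energy_comm j x :
  energy (modes_and_degrees j x) = modes_and_degrees j (energy x).
Proof.
case: j => [[u n]|n] /=.
  move: u; apply: weight_ind => [|k u wu] /=.
    split=> [|a u v hu hv] /=.
      by rewrite !YM0l linop0 //; apply: energy_lin.
    by rewrite !YM_linl energy_lin hu hv.
  rewrite /energy (omega_commutator _ _ wu) (degree_commutator _ _ wu).
  by rewrite opprD addrACA subrr addr0 (linopB (YM_lin _ _)).
rewrite /energy (linopB (component_lin dM n)) hD (degreeE (j := n%:Z)); last first.
  exact: component_in.
congr (_ - _); move: x; apply: (ds_ext dM) => [a x y|a x y|m x mx].
- by rewrite component_lin // YM_lin.
- by rewrite YM_lin component_lin.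
have := deg_compat (omega_weight V) 1 mx.
have -> : m%:Z + 2 - 1 - 1 = m by lia.
move=> om; rewrite (int_graded_component _ om) (int_graded_component (j := m%:Z) _ mx).
by case: eqP => // _; rewrite YM0r.
Qed.

(* A D-stable subspace contains the homogeneous components of its elements:
   (D - B) kills the top component and rescales the others. *)
Lemma degree_stable_graded (S : set M) : subspace S ->
  (forall x, S x -> S (D x)) -> forall n x, S x -> S (pi n x).
Proof.
move=> hS iS n x Sx; have [B hB] := component_bound dM x.
elim: B x Sx hB n => [|B IH] x Sx hB n; first by rewrite hB //; case: hS.
pose y := D x - B%:R *: x.
have piy m : pi m y = (m%:R - B%:R) *: pi m x.
  by rewrite /y (linopB (component_lin dM m)) hD (linopZ (component_lin dM m)) scalerBl.
have low m : (m < B)%N -> S (pi m x).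
  move=> mB.
  have : S (pi m y).
    apply: IH => [|l Bl]; first by apply: subspaceB; [|exact: iS|exact: subspaceZ].
    rewrite piy; move: Bl; rewrite leq_eqVlt => /orP[/eqP->|Bl].
      by rewrite subrr scale0r.
    by rewrite hB ?scaler0.
  rewrite piy => /(subspaceZ (m%:R - B%:R)^-1 hS); rewrite scalerA mulVf ?scale1r //.
  by rewrite subr_eq0 eqr_nat ltn_eqF.
case: (ltngtP n B) => [/low //|Bn|->]; first by rewrite hB //; case: hS.
have -> : pi B x = x - \sum_(i < B) pi i x.
  apply: (component_ext dM) => m; rewrite (linopB (component_lin dM m)).
  rewrite (linop_sum (component_lin dM m)).
  have pipi i : pi m (pi i x) = if i == m then pi m x else 0.
    case: eqP => [->|im]; first by rewrite component_id //; apply: component_in.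
    by apply: component_other im => //; apply: component_in.
  under eq_bigr => i _ do rewrite pipi.
  rewrite pipi; case: (ltngtP m B) => [mB|Bm|->].
  - rewrite (bigD1 (Ordinal mB)) //= eqxx big1 ?addr0 ?subrr // => i.
    by rewrite -val_eqE /= => /negPf ->.
  - by rewrite hB // big1 ?subrr // => i _; case: ifP.
  - rewrite big1 ?subr0 // => i _.
    by rewrite ltn_eqF.
by apply: subspaceB => //; apply: subspace_sum => // i _; apply: low.
Qed.

End Graded.

(* On a graded irreducible module L(0) minus the degree is a scalar, so every
   submodule is automatically graded. *)
Lemma graded_irreducible_modes (F : numClosedFieldType) (V : voa F)
    (M : admissible_module V) (P : set M) : ~ countable [set: F] ->
  adm_irreducible P -> Defs.irreducible (modes M) P.
Proof.
move=> hF /adm_irreducibleP irrP; have [[hP iP] Pn0 minP] := irrP.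
have dM := deg_direct_sum M.
have [D hD] := degree_operator M.
have [e he] := graded_irreducible_countable irrP.
have DP x : P x -> P (D x).
  move=> Px; have [r [_ _ ->]] := component_decomp dM (D x).
  apply: subspace_sum => // n _; rewrite hD; apply: subspaceZ => //.
  exact: (iP (inr n)).
have [|||c hc] := @schur _ _ _ _ P e (energy D) hF (@modes_and_degrees_lin _ _ M) irrP he.
- by move=> x Px; apply: subspaceB => //; [apply: (iP (inl (omega V, 1)))|apply: DP].
- by move=> a x y _ _; apply: energy_lin.
- by move=> j x _; apply: energy_comm.
split=> //; first by split=> // p x; apply: (iP (inl p)).
move=> T [hT iT] TP; apply: minP => //; split=> // -[p|n] x Tx; first exact: iT.
apply: (degree_stable_graded hD) => // z Tz.
have -> : D z = YM M (omega V) 1 z - c *: z.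
  by rewrite -hc; [rewrite /energy opprB addrC addrNK|apply: TP].
by apply: subspaceB => //; [apply: (iT (omega V, 1))|apply: subspaceZ].
Qed.

Lemma rational_modes_spanned (F : numClosedFieldType) (V : voa F)
    (M : admissible_module V) : ~ countable [set: F] -> rational_voa V ->
  spanned_by_irreducibles (modes M) setT.
Proof.
move=> hF /(_ M)[I [S [irrS [_ dS _]]]]; rewrite /spanned_by_irreducibles -dS.
apply: lin_span_mono => x [i _ Sx]; exists (S i) => //; split; last by rewrite dS.
exact: graded_irreducible_modes.
Qed.

Lemma schur_modes (F : numClosedFieldType) (V : voa F) (M : weak_module V) P theta :
  ~ countable [set: F] -> Defs.irreducible (modes M) P ->
  hom_on (modes M) P theta -> (forall x, P x -> P (theta x)) ->
  exists c, forall x, P x -> theta x = c *: x.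
Proof.
move=> hF irrP [lt ct] tP; have [e he] := irreducible_countable irrP.
exact: (@schur _ _ _ _ P e theta hF (@modes_lin _ _ M) irrP he).
Qed.

(** * Restriction of admissible modules along a map of VOAs *)

Section Restriction.
Variables (F : numFieldType) (V U : voa F) (h : V -> U).
Hypothesis h_lin : linear h.
Hypothesis h_vac : h (vac V) = vac U.
Hypothesis h_Y : forall a n b, h (Y V a n b) = Y U (h a) n (h b).
Hypothesis h_weight : forall k a, weight k a -> weight k (h a).
Variable M : admissible_module U.

Let YR (a : V) : int -> M -> M := YM M (h a).

Let YR_operators : vertex_operators YR.
Proof.
split=> [n w a u v|u n|u w]; first by rewrite /YR h_lin YM_linl.
  exact: YM_lin.
exact: truncated.
Qed.

Let YR_vacuum : vacuum_axiom (vac V) YR.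
Proof. by move=> n w; rewrite /YR h_vac vacYM. Qed.

Let YR_jacobi : jacobi (Y V) YR.
Proof.
move=> u v w l m n; apply: etrans (YM_jacobi (h u) (h v) w l m n).
by apply: eq_fsbigr => i _; rewrite /YR h_Y.
Qed.

Let restricted : weak_module V := WeakModule YR_operators YR_vacuum YR_jacobi.

Let restricted_deg (k : int) (u : V) : weight k u ->
  forall (m : int) (n : nat) (x : restricted), deg M n x ->
    int_graded 0 (deg M) (n%:Z + k - m - 1) (YM restricted u m x).
Proof. by move=> /h_weight wu m n x; apply: deg_compat. Qed.

(** The inclusion of a tensor factor need not send its Virasoro vector to that of [U]; preservation
    of weights, [h_weight], is what lets the degrees of [M] serve for the restriction. *)
Definition restricted_module : admissible_module V :=
  @AdmissibleModule F V restricted (deg M) (deg_direct_sum M) restricted_deg.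

End Restriction.

Lemma complemented_equiv (F : numFieldType) (M : lmodType F) (J J' : Type)
    (op : J -> M -> M) (op' : J' -> M -> M) :
  (forall S, Defs.invariant op S <-> Defs.invariant op' S) ->
  complemented op -> complemented op'.
Proof.
by move=> e c S /e /c [T [iT ST STT]]; exists T; split=> //; apply/e.
Qed.

(** Stands in for the spanning by pure tensors: [f] and 0 both factor the zero bilinear map, so the
    uniqueness clause identifies them. *)
Lemma tensor_eq0 (F : numFieldType) (A B T X : lmodType F) (t : A -> B -> T)
    (f : T -> X) : is_tensor t -> linear f -> (forall a b, f (t a b) = 0) ->
  forall z, f z = 0.
Proof.
move=> [_ univ] lf f0 z.
have [|g _ guniq] := univ X (fun _ _ => 0).
  by split=> [b|a] c x y; rewrite scaler0 addr0.
pose fL : {linear T -> X} := HB.pack f (GRing.isLinear.Build F T X *:%R f lf).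
rewrite -[f z]/(fL z) guniq //.
by have /(_ z) <- := guniq (\0 : {linear T -> X}) (fun _ _ => erefl).
Qed.

(** * Semisimplicity over the tensor product of two rational VOAs *)

Section TensorProduct.
Variables (F : numClosedFieldType) (W N T U : voa F) (t : W -> N -> T).
Variable f0 : {linear T -> U}.
Hypothesis F_uncountable : ~ countable [set: F].
Hypothesis W_rational : rational_voa W.
Hypothesis N_rational : rational_voa N.
Hypothesis hT : is_tensor_voa t.
Hypothesis f0_vac : f0 (vac T) = vac U.
Hypothesis f0_omega : f0 (omega T) = omega U.
Hypothesis f0_Y : forall x n y, f0 (Y T x n y) = Y U (f0 x) n (f0 y).
Variable M : admissible_module U.

Let t_linl b : linear (fun a => t a b). Proof. by case: hT => -[[]]. Qed.
Let t_linr a : linear (t a). Proof. by case: hT => -[[]]. Qed.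
Let t0l b : t 0 b = 0. Proof. exact: linop0 (t_linl b). Qed.
Let t0r a : t a 0 = 0. Proof. exact: linop0 (t_linr a). Qed.
Let tZl c a b : t (c *: a) b = c *: t a b. Proof. exact: linopZ (t_linl b) c a. Qed.
Let tZr c a b : t a (c *: b) = c *: t a b. Proof. exact: linopZ (t_linr a) c b. Qed.

Let t_modes a b n p q :
  Y T (t a b) n (t p q) = \sum_(i \in [set: int]) t (Y W a i p) (Y N b (n - 1 - i) q).
Proof. by case: hT. Qed.

Let vacY (V : voa F) n v : Y V (vac V) n v = if n == -1 then v else 0.
Proof. exact: Y_vacuum. Qed.

Let fsum_int (X : lmodType F) (f : int -> X) i0 :
  (forall i, i <> i0 -> f i = 0) -> \sum_(i \in [set: int]) f i = f i0.
Proof.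
move=> f0'; transitivity (\sum_(i \in [set i0]) f i); last exact: fsbig_set1.
apply/esym/fsbig_widen => // i [_ ii0].
by apply: f0' => e; apply: ii0; rewrite e.
Qed.

Let modeWl a n p q : Y T (t a (vac N)) n (t p q) = t (Y W a n p) q.
Proof.
rewrite t_modes (@fsum_int _ _ n) => [|i ni]; rewrite vacY.
  by rewrite (_ : n - 1 - n = -1) //; lia.
by case: eqP => [|_]; [lia|rewrite t0r].
Qed.

Let modeNr b n p q : Y T (t (vac W) b) n (t p q) = t p (Y N b n q).
Proof.
rewrite t_modes (@fsum_int _ _ (-1)) => [|i ni]; rewrite vacY.
  by rewrite eqxx; congr (t _ (Y N _ _ _)); lia.
by case: eqP => [//|_]; rewrite t0l.
Qed.

Let vacT : vac T = t (vac W) (vac N). Proof. by case: hT. Qed.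
Let omegaT : omega T = t (omega W) (vac N) + t (vac W) (omega N).
Proof. by case: hT. Qed.

Let YTDl x y n z : Y T (x + y) n z = Y T x n z + Y T y n z.
Proof. exact: linopD (Y_linl n z) x y. Qed.

Definition left_factor a := f0 (t a (vac N)).
Definition right_factor b := f0 (t (vac W) b).

Let left_lin : linear left_factor.
Proof. by move=> c a b; rewrite /left_factor t_linl linearP. Qed.

Let right_lin : linear right_factor.
Proof. by move=> c a b; rewrite /right_factor t_linr linearP. Qed.

Let left_vac : left_factor (vac W) = vac U.
Proof. by rewrite /left_factor -vacT. Qed.

Let right_vac : right_factor (vac N) = vac U.
Proof. by rewrite /right_factor -vacT. Qed.

Let left_Y a n b : left_factor (Y W a n b) = Y U (left_factor a) n (left_factor b).
Proof. by rewrite /left_factor -f0_Y modeWl. Qed.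

Let right_Y a n b : right_factor (Y N a n b) = Y U (right_factor a) n (right_factor b).
Proof. by rewrite /right_factor -f0_Y modeNr. Qed.

Let left_weight k a : weight k a -> weight k (left_factor a).
Proof.
rewrite /weight /= => wa; rewrite -f0_omega -f0_Y omegaT YTDl modeWl modeNr.
by rewrite wa (Y_creation _).2 // t0r addr0 tZl linearZ.
Qed.

Let right_weight k a : weight k a -> weight k (right_factor a).
Proof.
rewrite /weight /= => wa; rewrite -f0_omega -f0_Y omegaT YTDl modeWl modeNr.
by rewrite wa (Y_creation _).2 // t0l add0r tZr linearZ.
Qed.

Let MW := restricted_module left_lin left_vac left_Y left_weight M.
Let MN := restricted_module right_lin right_vac right_Y right_weight M.

(** The nonnegative modes of [a (x) 1] on [1 (x) b] are [(a_k 1) (x) b = 0], so the commutator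
    formula has no terms. *)
Let factors_commute i j (x : M) :
  modes MW i (modes MN j x) = modes MN j (modes MW i x).
Proof.
apply: (@modes_commute _ U M (left_factor i.1) (right_factor j.1)) => k.
rewrite /left_factor /right_factor -f0_Y modeWl.
by rewrite (Y_creation _).2 // t0l linear0.
Qed.

Let factors_complemented : complemented (both (modes MW) (modes MN)).
Proof.
have spW := @rational_modes_spanned F W MW F_uncountable W_rational.
have spN := @rational_modes_spanned F N MN F_uncountable N_rational.
have linW := @modes_lin F W MW; have linN := @modes_lin F N MN.
apply: (spanned_complemented (op := both (modes MW) (modes MN))).
  exact: (both_lin linW linN).
apply: (both_spanned linW linN factors_commute) => //.
- exact: (spanned_complemented linW).
- exact: (spanned_complemented linN).
- by move=> P theta; apply: schur_modes.
Qed.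

(** [a (x) b] is the mode [-1] of [a (x) 1] on [1 (x) b], so [T] and the pair [W], [N] have the same
    invariant subspaces. *)
Theorem tensor_complemented : complemented (fun p : T * int => YM M (f0 p.1) p.2).
Proof.
apply: complemented_equiv factors_complemented => S.
split=> [iS|[hS iS]]; last first.
  by split=> // -[[a n]|[b n]] x Sx; [apply: (iS (_, _))|apply: (iS (_, _))].
have lin_both := both_lin (@modes_lin F W MW) (@modes_lin F N MN).
(* The universal property speaks of linear maps, so membership of [z_n x] in [S] is recast, through
   a projection onto [S], as the vanishing of a map linear in [z]. *)
have [rho [lrho rS rid] _] := complement_projection lin_both factors_complemented iS.
have [hS _] := iS; split=> // -[z n] x Sx /=.
suff : YM M (f0 z) n x - rho (YM M (f0 z) n x) = 0 by move=> /subr0_eq ->.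
pose sigma z := YM M (f0 z) n x - rho (YM M (f0 z) n x).
rewrite -[LHS]/(sigma z); apply: (tensor_eq0 (t := t)) => [|c u v|a b].
- by case: hT.
- by rewrite /sigma linearP YM_linl lrho opprD addrACA scalerBr.
rewrite /sigma rid ?subrr //.
have -> : t a b = Y T (t a (vac N)) (-1) (t (vac W) b).
  by rewrite modeWl (Y_creation _).1.
rewrite f0_Y; apply: mode_of_product => // p q.
by apply: (iS.2 (inl (a, p))); apply: (iS.2 (inr (b, q))).
Qed.

End TensorProduct.

Definition adjoint_module (F : numFieldType) (V : voa F) : weak_module V :=
  WeakModule (Y_operators V) (@Y_vacuum F V) (@Y_jacobi F V).

Lemma Z3_cases (i j : 'Z_3) : i != 0 -> [\/ j = 0, j = i | j = - i].
Proof.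
case: i j => [[|[|[|//]]] hi] [[|[|[|//]]] hj] // _.
- by constructor 1; apply: val_inj.
- by constructor 2; apply: val_inj.
- by constructor 3; apply: val_inj.
- by constructor 1; apply: val_inj.
- by constructor 3; apply: val_inj.
- by constructor 2; apply: val_inj.
Qed.

(** * Averaging a projection over the Z_3-grading *)

Section Averaging.
Variables (F : numFieldType) (U : voa F) (gr : 'Z_3 -> set U).
Hypothesis U_simple : simple_voa U.
Hypothesis gr_direct : direct_sum gr.
Hypothesis gr_Y : forall (i j : 'Z_3) u v n, gr i u -> gr j v -> gr (i + j) (Y U u n v).
Hypothesis gr_vac : gr 0 (vac U).
Variable M : admissible_module U.

Definition product_vac i := lin_span
  [set z | exists a b r, [/\ gr (- i) a, gr i b & z = Y U a r b]] (vac U).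

(** Write [x] as the mode [-1] of the vacuum on [x], expand the vacuum by [product_vac], and expand
    each mode of a product into products of modes. *)
Lemma product_vac_ind i (S : set M) x : product_vac i -> subspace S ->
  (forall a b p q, gr (- i) a -> gr i b -> S (YM M a p (YM M b q x))) -> S x.
Proof.
move=> vi hS Sab.
suff : S (YM M (vac U) (-1) x) by rewrite vacYM.
apply: (lin_span_min (S := [set u | S (YM M u (-1) x)]) _ _ vi).
  split=> [|c u v hu hv] /=; first by rewrite YM0l; case: hS.
  by rewrite YM_linl; apply: hS.2.
move=> _ [a [b [r [ga gb ->]]]] /=; apply: mode_of_product => // p q.
exact: Sab.
Qed.

(** By simplicity the vacuum is a combination of vectors [u_n x]; its component of degree 0 retains
    only the [u] of degree [-i]. *)
Lemma product_vac_neq0 i x : gr i x -> x <> 0 -> product_vac i.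
Proof.
move=> gx xn0.
pose S := lin_span [set z | exists a b r, [/\ gr (- i) a, gr i b & z = Y U a r b]].
have hS : subspace S by apply: lin_span_subspace.
have := modes_span_invariant (M := adjoint_module U) x.
set X := lin_span _ => iX.
have Xvac : X (vac U).
  have [_ _ minU] := U_simple; have [X0|->//] := minU X iX (@subsetT _ _).
  have : X x by apply: (modes_span_id (M := adjoint_module U)).
  by rewrite X0.
have lc0 := component_lin gr_direct (0 : 'Z_3).
suff h z : X z -> S (component gr 0 z).
  by have := h _ Xvac; rewrite component_id.
move=> Xz; apply: (lin_span_min (S := [set z | S (component gr 0 z)]) _ _ Xz).
  split=> [|c u v hu hv] /=; first by rewrite linop0 //; case: hS.
  by rewrite lc0; apply: hS.2.
move=> _ [u [n ->]] /=; move: u.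
apply: (ds_ind gr_direct) => /= [|j u gu].
  split=> [|c u v hu hv] /=.
    by rewrite (linop0 (Y_linl n x)) linop0 //; case: hS.
  by rewrite Y_linl lc0; apply: hS.2.
have gux := gr_Y n gu gx; have [ji|ji] := eqVneq (j + i) 0.
  rewrite component_id //; last by rewrite -ji.
  apply: sub_lin_span; exists u, x, n; split=> //.
  by rewrite -(eqP (_ : j == - i)) // -addr_eq0 ji.
by rewrite (component_other gr_direct gux); [case: hS|apply/eqP].
Qed.

Lemma product_vac_dichotomy :
  (forall i, product_vac i) \/ (forall i, i != 0 -> gr i = [set 0]).
Proof.
have [h|/existsNP[i /not_implyP[i0 gin0]]] :=
  pselect (forall i, i != 0 -> gr i = [set 0]); [by right|left].
have hgr j : subspace (gr j) by apply: (ds_subspace gr_direct).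
have [x gx xn0] := nonzero_subspace (hgr i) gin0.
have vi := product_vac_neq0 gx xn0.
(* Were the component [-i] zero, the vacuum, a combination of products from [-i] and [i], would
   vanish, and with it every vector. So one nonzero component other than 0 makes both nonzero. *)
have [y gy yn0] : exists2 y, gr (- i) y & y <> 0.
  apply: nonzero_subspace => // e; apply: xn0.
  suff v0 : vac U = 0.
    by have := @Y_vacuum F U (-1) x; rewrite v0 eqxx (linop0 (Y_linl _ _)).
  apply: (lin_span_min (S := [set 0]) _ _ vi); first exact: subspace_set0.
  by move=> _ [a [b [r [ga _ ->]]]]; rewrite e in ga; rewrite ga (linop0 (Y_linl _ _)).
move=> j; have [->|->|->] := Z3_cases j i0.
- apply: sub_lin_span; exists (vac U), (vac U), (-1); rewrite oppr0.
  by split=> //; rewrite (Y_creation _).1.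
- exact: vi.
- exact: product_vac_neq0 gy yn0.
Qed.

Variables (A : set M) (rho : M -> M).
Hypothesis A_inv : Defs.invariant (@modes_and_degrees _ _ M) A.
Hypothesis rho_proj : is_projection A rho.
Hypothesis rho_comm : forall u n x, gr 0 u -> rho (YM M u n x) = YM M u n (rho x).

Let A_sub : subspace A. Proof. by case: A_inv. Qed.
Let A_mode u n x : A x -> A (YM M u n x). Proof. exact: (A_inv.2 (inl (u, n))). Qed.
Let rho_lin : linear rho. Proof. by case: rho_proj. Qed.
Let rho_in x : A (rho x). Proof. by case: rho_proj. Qed.
Let rho_id x : A x -> rho x = x. Proof. by case: rho_proj => _ _; apply. Qed.

(* The twist tau_i of rho, characterised by v_n (tau_i x) = rho (v_n x) for v
   of degree i, satisfies u_n (tau_i x) = tau_(i-j) (u_n x) for u of degree j;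
   hence the mean of the tau_i commutes with all modes. *)
Lemma averaged_projection : (forall i, product_vac i) ->
  exists2 rho', is_projection A rho' & forall u n x, rho' (YM M u n x) = YM M u n (rho' x).
Proof.
move=> hvac.
(* Modes of degree [i] separate vectors, since every vector is recovered from their values by modes
   of degree [-i]. *)
have unique i y z : (forall v n, gr i v -> YM M v n y = YM M v n z) -> y = z.
  move=> yz; apply/subr0_eq.
  apply: (product_vac_ind (S := [set 0]) (hvac i)); first exact: subspace_set0.
  move=> a b p q _ gb /=; rewrite (linopB (YM_lin _ _)) yz // subrr.
  exact: YM0r.
have exist i (x : M) : exists y, A y /\ forall v n, gr i v -> YM M v n y = rho (YM M v n x).
  pose S := [set x | exists y, A y /\ forall v n, gr i v ->
    YM M v n y = rho (YM M v n x)].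
  apply: (product_vac_ind (S := S) (hvac i)) => [|a b p q ga gb].
    split=> [|c y z [y' [Ay' hy]] [z' [Az' hz]]].
      exists 0; split=> [|v n gv]; first by case: A_sub.
      by rewrite YM0r linop0.
    exists (c *: y' + z'); split=> [|v n gv]; first exact: A_sub.2.
    by rewrite !YM_lin rho_lin hy // hz.
  (* The twist of [a_p b_q x] is [a_p rho(b_q x)]: for [v] of degree [i] the products [v_k a] have
     degree 0, so their modes commute with [rho]. *)
  exists (YM M a p (rho (YM M b q x))); split; first exact: A_mode.
  move=> v n gv; apply: product_of_modes_intertwined => // k l.
  by rewrite [RHS]rho_comm //; have := gr_Y k gv ga; rewrite subrr.
have /choice[tau htau] : forall ix : 'Z_3 * M, exists y, A y /\
    forall v n, gr ix.1 v -> YM M v n y = rho (YM M v n ix.2).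
  by move=> [i x]; apply: exist.
have tau_in i x : A (tau (i, x)) by case: (htau (i, x)).
have tauP i x v n : gr i v -> YM M v n (tau (i, x)) = rho (YM M v n x).
  by case: (htau (i, x)) => _; apply.
have tau_lin i : linear (fun x => tau (i, x)).
  move=> a x y; apply: (unique i) => v n gv.
  by rewrite tauP // !YM_lin rho_lin !tauP.
have tau_id i x : A x -> tau (i, x) = x.
  by move=> Ax; apply: (unique i) => v n gv; rewrite tauP // rho_id //; apply: A_mode.
have tau_mode i j u n x : gr j u -> YM M u n (tau (i, x)) = tau (i - j, YM M u n x).
  move=> gu; apply: (unique (i - j)) => v m gv; rewrite [RHS]tauP //.
  apply: product_of_modes_intertwined => // k l; rewrite tauP //.
  by have := gr_Y k gv gu; rewrite subrK.
exists (fun x => (3%:R : F)^-1 *: \sum_i tau (i, x)).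
  split=> [a x y|x|x Ax].
  - under eq_bigr => i _ do rewrite tau_lin.
    by rewrite big_split /= -scaler_sumr scalerDr !scalerA mulrC.
  - by apply: subspaceZ => //; apply: subspace_sum.
  - under eq_bigr => i _ do rewrite tau_id //.
    rewrite sumr_const card_ord -scaler_nat scalerA mulVf ?scale1r //.
    by rewrite pnatr_eq0.
move=> u n x; rewrite (linopZ (YM_lin _ _)); congr (_ *: _).
move: u; apply: (ds_ind gr_direct) => [|j u gu] /=.
  split=> [|c u v hu hv] /=.
    rewrite !YM0l big1 // => i _; exact: linop0 (tau_lin i).
  rewrite !YM_linl -hu -hv scaler_sumr -big_split.
  by apply: eq_bigr => i _; rewrite tau_lin.
rewrite (linop_sum (YM_lin _ _)) (reindex_inj (addIr (- j))) /=.
by apply: eq_bigr => i _; rewrite (tau_mode _ j).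
Qed.

Lemma equivariant_projection :
  exists2 rho', is_projection A rho' & forall u n x, rho' (YM M u n x) = YM M u n (rho' x).
Proof.
have [|triv] := product_vac_dichotomy; first exact: averaged_projection.
exists rho => // u n x; move: u; apply: (ds_ind gr_direct) => [|j u gu] /=.
  split=> [|c u v hu hv] /=; first by rewrite !YM0l linop0.
  by rewrite !YM_linl rho_lin hu hv.
have [j0|jn0] := eqVneq j 0; first by apply: rho_comm; rewrite -j0.
have -> : u = 0 by have : gr j u by []; rewrite triv.
by rewrite !YM0l linop0.
Qed.

End Averaging.

(** * Graded projections and the rationality of the extension *)

(** The degree 0 part of [rho] is the sum over [n] of [pi n rho pi n]. It still commutes with the
    modes of a homogeneous [u], because each of these only shifts degrees. *)
Lemma graded_projection (F : numFieldType) (V : voa F) (M : admissible_module V)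
    (A : set M) rho :
  Defs.invariant (@modes_and_degrees _ _ M) A -> is_projection A rho ->
  (forall u n x, rho (YM M u n x) = YM M u n (rho x)) ->
  exists2 rho', is_projection A rho' &
    forall j x, rho' (modes_and_degrees j x) = modes_and_degrees j (rho' x).
Proof.
move=> [hA iA] [lrho rA rid] rcomm.
have dM := deg_direct_sum M; pose pi := component (deg M).
have lpi n : linear (pi n) by apply: component_lin.
have /choice[rho' hrho] : forall x, exists y, forall n, pi n y = pi n (rho (pi n x)).
  move=> x; have [B hB] := component_bound dM x.
  apply: (glue dM (B := B)) => n; first exact: component_in.
  by move=> /hB; rewrite /pi => ->; rewrite linop0 // linop0.
have lrho' : linear rho'.
  move=> a x y; apply: (component_ext dM) => n; rewrite -/(pi n).
  by rewrite hrho !(lpi n, lrho) !hrho.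
exists rho'.
  split=> // [x|x Ax].
    have [r [_ _ ->]] := component_decomp dM (rho' x).
    apply: subspace_sum => // n _; rewrite -/(pi n) hrho.
    by apply: (iA (inr n)); apply: rA.
  apply: (component_ext dM) => n; rewrite -/(pi n) hrho rid; last exact: (iA (inr n)).
  by rewrite /pi component_id //; apply: component_in.
move=> [[u m]|m] x /=; last first.
  apply: (component_ext dM) => n; rewrite -/pi hrho.
  have pipi y : pi n (pi m y) = if m == n then pi n y else 0.
    case: eqP => [->|mn]; first by rewrite /pi component_id //; apply: component_in.
    by apply: (component_other dM _ mn); apply: component_in.
  by rewrite !pipi; case: ifP; rewrite ?hrho // !linop0.
move: u; apply: weight_ind => [|k u wu] /=.
  split=> [|c u v hu hv] /=; first by rewrite !YM0l linop0.
  by rewrite !YM_linl lrho' hu hv.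
apply: (component_ext dM) => N; rewrite -/pi hrho.
have [|y z|[n hn]|h0] := component_shift dM (f := YM M u m) (s := k - m - 1) _ _ N.
- exact: YM_lin.
- by rewrite !addrA; apply: deg_compat.
- by rewrite /pi !hn rcomm hn -/(pi n) -hrho.
- by rewrite -/(pi N) in h0; rewrite h0 linop0 // linop0 // h0.
Qed.

Theorem extension_rational (F : numClosedFieldType) (W N : voa F)
    (Wp Wm : weak_module W) (Np Nm : weak_module N) (U : voa F) :
  ~ countable [set: F] -> rational_voa W -> rational_voa N ->
  is_Z3_extension Wp Wm Np Nm U -> rational_voa U.
Proof.
move=> hF ratW ratN [simU [gr [dgr grY [T [t [f0 [hT [_ f0r f0vac f0omega f0Y] _ _]]]]]]] M.
have gr_vac : gr 0 (vac U) by rewrite -f0r -f0vac; exists (vac T).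
have compl0 := @tensor_complemented _ _ _ _ _ _ _ hF ratW ratN hT f0vac f0omega f0Y M.
have lin0 (p : T * int) : linear (YM M (f0 p.1) p.2) by exact: YM_lin.
have compl : complemented (@modes_and_degrees _ _ M).
  move=> A iA; have iA0 : Defs.invariant (fun p : T * int => YM M (f0 p.1) p.2) A.
    by split=> [|p x Ax]; [case: iA|apply: (iA.2 (inl (f0 p.1, p.2)))].
  have [rho rho_proj rho_comm0] := complement_projection lin0 compl0 iA0.
  have rho_comm u n x : gr 0 u -> rho (YM M u n x) = YM M u n (rho x).
    by rewrite -f0r => -[z _ <-]; apply: (rho_comm0 (z, n)).
  have [rho1 proj1 comm1] :=
    equivariant_projection simU dgr grY gr_vac iA rho_proj rho_comm.
  have [rho2 proj2 comm2] := graded_projection iA proj1 comm1.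
  exact: (projection_complement (@modes_and_degrees_lin _ _ M) iA proj2 comm2).
have [I [S [irrS dS]]] := complemented_direct_sum (@modes_and_degrees_lin _ _ M) compl.
by exists I, S; split=> // i; apply/adm_irreducibleP.
Qed.

(** The real interval from 0 to 1 embeds in the field and has Lebesgue measure 1, whereas a
    countable set has measure 0. *)
Lemma complex_uncountable (R : realType) : ~ countable [set: R[i]].
Proof.
move=> /countable_injP[f finj].
have cR : countable [set` `[0, 1 : R]].
  apply/countable_injP; exists (fun x : R => f x%:C%C) => x y _ _ fxy.
  by have [] := finj _ _ (in_setT _) (in_setT _) fxy.
have := lebesgue_measure.countable_lebesgue_measure0 cR.
rewrite lebesgue_measure.lebesgue_measure_itv /= constructive_ereal.lte01.
by move=> -[] /eqP; rewrite subr0 oner_eq0.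
Qed.

Theorem theorem4p10 (R : realType) (W N : voa R[i])
    (Wp Wm : weak_module W) (Np Nm : weak_module N) (U : voa R[i])
    (hW : is_W0 W) (hW_rational : rational_voa W)
    (hN : is_N0 N) (hN_rational : rational_voa N)
    (hWpm : is_W23_pair Wp Wm) (hNpm : is_N43_pair Np Nm)
    (hU : is_Z3_extension Wp Wm Np Nm U) :
  rational_voa U.
Proof.
exact: extension_rational (@complex_uncountable R) hW_rational hN_rational hU.
Qed.
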